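(* Let $P$ be a convex polygon with $n \ge 3$ vertices, and let $m \ge 1$ be an integer such that $n \in \{3\cdot 2^{m-1}+1, \dots, 3\cdot 2^m\}$. Then any triangulation of $P$ that minimizes the dual diameter among all triangulations of $P$ has dual diameter exactly $2\cdot\lceil \log_2(n/3)\rceil - 1$ if $n \in \{3\cdot 2^{m-1}+1, \dots, 4\cdot 2^{m-1}\}$, and exactly $2\cdot\lceil \log_2(n/3)\rceil$ if $n \in \{4\cdot 2^{m-1}+1, \dots, 3\cdot 2^m\}$.
   Context: A simple polygon $P$ is regarded as a closed two-dimensional subset of the plane, including its boundary. A triangulation $T$ of $P$ is a maximal crossing-free straight-line graph whose vertices are the vertices of $P$ and whose edges lie inside $P$; all its bounded faces are triangles. The dual graph $T^*$ has one vertex for each bounded face (triangle) of $T$ and an edge between two vertices if and only if the corresponding triangles share an edge of $T$. The dual diameter of $T$ is the graph diameter of $T^*$ (path length is the number of edges). *)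

(* Defs.v *)
From HB Require Import structures.
From mathcomp Require Import all_boot all_order all_algebra.
From mathcomp Require Import all_classical all_reals all_analysis.
Import numFieldNormedType.Exports.

Set Implicit Arguments.
Unset Strict Implicit.
Unset Printing Implicit Defensive.

Import Order.TTheory GRing.Theory Num.Theory.

Local Open Scope classical_set_scope.
Local Open Scope ring_scope.

Section Geometry.
Variable R : realType.
Notation plane := (R * R)%type.

Definition conv_hull (A : set plane) : set plane :=
  smallest (fun B : set plane => @convex_set R plane B) A.

Definition segm (a b : plane) : set plane :=
  [set (1 - t) *: a + t *: b | t in `[0, 1]].

Definition open_segm (a b : plane) : set plane :=
  [set (1 - t) *: a + t *: b | t in `]0, 1[].

(* The vertices are the extreme points of P, so consecutive sides are never
   collinear; they are labelled in no particular order.  In particular v is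
   injective, and P has nonempty interior as soon as 3 <= n. *)
Definition convex_polygon n (v : 'I_n -> plane) (P : set plane) :=
  P = conv_hull (range v) /\
  forall i, ~ conv_hull [set v j | j in [set j | j != i]] (v i).

Definition simple_graph (V : Type) (e : rel V) :=
  symmetric e /\ irreflexive e.

Definition crossing_free n (v : 'I_n -> plane) (e : rel 'I_n) :=
  (forall i j k, e i j -> ~ open_segm (v i) (v j) (v k)) /\
  (forall i j k l, e i j -> e k l -> [set i; j] <> [set k; l] ->
     open_segm (v i) (v j) `&` open_segm (v k) (v l) = set0).

Definition plane_graph_in n (v : 'I_n -> plane) (P : set plane)
    (e : rel 'I_n) :=
  [/\ simple_graph e, crossing_free v e &
      forall i j, e i j -> segm (v i) (v j) `<=` P].

Definition triangulation n (v : 'I_n -> plane) (P : set plane)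
    (e : rel 'I_n) :=
  plane_graph_in v P e /\
  forall e' : rel 'I_n, plane_graph_in v P e' ->
    (forall i j, e i j -> e' i j) -> forall i j, e' i j -> e i j.

Definition drawing n (v : 'I_n -> plane) (e : rel 'I_n) : set plane :=
  range v `|`
  [set x | exists i j, e i j /\ segm (v i) (v j) x].

Definition bounded_faces n (v : 'I_n -> plane) (e : rel 'I_n) :
    set (set plane) :=
  [set F | bounded_set F /\
     exists2 x, (~` drawing v e) x &
       F = connected_component (~` drawing v e) x].

(* Faces are open sets; the triangle of a bounded face is its closure. *)
Definition dual_adj n (v : 'I_n -> plane) (e : rel 'I_n) (F G : set plane) :=
  [/\ bounded_faces v e F, bounded_faces v e G, F <> G &
      exists i j, e i j /\
        segm (v i) (v j) `<=` closure F `&` closure G].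

Fixpoint walk (V : Type) (adj : V -> V -> Prop) (k : nat) (x y : V) : Prop :=
  if k is k'.+1 then exists z, adj x z /\ walk adj k' z y else x = y.

(* Extended reals: the distance is +oo between different components. *)
Definition graph_dist (V : Type) (adj : V -> V -> Prop) (x y : V) : \bar R :=
  ereal_inf [set k%:R%:E | k in [set k : nat | walk adj k x y]].

Definition graph_diameter (V : Type) (S : set V) (adj : V -> V -> Prop) :
    \bar R :=
  ereal_sup [set graph_dist adj xy.1 xy.2 | xy in S `*` S].

Definition dual_diameter n (v : 'I_n -> plane) (e : rel 'I_n) : \bar R :=
  graph_diameter (bounded_faces v e) (dual_adj v e).

Definition min_dual_diameter_triangulation n (v : 'I_n -> plane)
    (P : set plane) (e : rel 'I_n) :=
  triangulation v P e /\
  forall e' : rel 'I_n, triangulation v P e' ->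
    (dual_diameter v e <= dual_diameter v e')%E.

Definition log2 (x : R) : R := ln x / ln 2.

End Geometry.

(* Main.v *)
(* List the vertices counterclockwise as w 0, ..., w (n-1).  Two chords meet in
   their interiors iff their ends interleave, so by maximality a triangulation
   is a binary tree: a chord (a, b) is either a side, or carries a triangle
   (a, c, b) and the subtrees of the chords (a, c) and (c, b).  Locating a point
   by descending this tree shows that the bounded faces are exactly the open
   triangles of the tree.  A walk in the dual graph crosses at most one chord
   per step, hence its length is at least the number of chords separating its
   ends, and the dual diameter equals the diameter of the tree.  Finally, a
   binary tree of diameter D has at most 3 * 2^(D/2) - 1 (D even) or
   4 * 2^((D-1)/2) - 1 (D odd) leaves, these bounds are attained, and all smaller
   positive numbers of leaves occur; an n-gon corresponds to n - 1 leaves. *)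

Require Import Defs.
From HB Require Import structures.
From mathcomp Require Import all_boot all_order all_algebra.
From mathcomp Require Import all_classical all_reals all_analysis.
From mathcomp Require Import zify ring lra.
Import numFieldNormedType.Exports.

Set Implicit Arguments.
Unset Strict Implicit.
Unset Printing Implicit Defensive.

Import Order.TTheory GRing.Theory Num.Theory.

(** The constants 3 and 4 come from the centre of a longest dual path: a central triangle carries
    three full subtrees with 2 ^ (D/2) sides each, and a central edge joins two triangles that carry
    four subtrees with 2 ^ ((D-1)/2) sides each. Hanging the tree from one of its sides hides this
    symmetry, so the counting arguments follow the branch that leads to that side. The geometry
    enters only through signs of determinants, and the dual graph is never determined completely. It
    is enough that the graph [e] is noncrossing and contains the edges of a tree [t]: this fixes the
    bounded faces, adjacency of parent and child bounds distances from above, and separating tree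
    chords bound them from below. *)

(** * Binary trees *)

(* A leaf is a side of the polygon; an inner node is a triangle, its two
   children hanging on the two lower sides of the triangle. *)
Inductive btree := Leaf | Node of btree & btree.

Fixpoint leaves t := if t is Node l r then (leaves l + leaves r) else 1.

Fixpoint height t :=
  if t is Node l r then (maxn (height l) (height r)).+1 else 0.

(* Number of dual edges between farthest inner nodes; the two deepest nodes
   below a node lie at distances height l and height r from it. *)
Fixpoint diam t :=
  if t is Node l r
  then maxn (maxn (diam l) (diam r)) (height l + height r) else 0.

(* The tree t is drawn on the vertices a, ..., a + leaves t, its root hanging
   on the chord (a, a + leaves t). *)
Fixpoint edges a t : seq (nat * nat) :=
  (a, (a + leaves t)) ::
    (if t is Node l r then edges a l ++ edges (a + leaves l) r else [::]).

Fixpoint tris a t : seq (nat * nat * nat) :=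
  if t is Node l r
  then (a, (a + leaves l), (a + leaves t)) ::
         (tris a l ++ tris (a + leaves l) r)
  else [::].

Lemma leaves_gt0 t : (0 < leaves t).
Proof. by elim: t => //= l hl r hr; rewrite addn_gt0 hl. Qed.

Lemma edges_top a t : (a, (a + leaves t)) \in edges a t.
Proof. by case: t => [|l r]; rewrite inE eqxx. Qed.

Lemma edges_bound t a p q :
  (p, q) \in edges a t -> (a <= p /\ p < q /\ q <= a + leaves t).
Proof.
elim: t a => [|l IHl r IHr] a /=; rewrite inE.
  by move/eqP=> [-> ->]; lia.
have := leaves_gt0 l; have := leaves_gt0 r => gr gl.
case/orP => [/eqP[-> ->]|]; first by lia.
by rewrite mem_cat => /orP[/IHl|/IHr]; lia.
Qed.

Lemma tris_edges t a i j k : (i, j, k) \in tris a t ->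
  [/\ (i, j) \in edges a t, (j, k) \in edges a t & (i, k) \in edges a t].
Proof.
elim: t a => [//|l IHl r IHr] a /=; rewrite !inE !mem_cat.
case/orP => [/eqP[-> -> ->]|/orP[/IHl|/IHr] []].
- by rewrite eqxx edges_top addnA edges_top !orbT.
- by move=> -> -> ->; rewrite !orbT.
- by move=> -> -> ->; rewrite !orbT.
Qed.

Lemma tris_bound t a i j k : (i, j, k) \in tris a t ->
  (a <= i /\ i < j /\ j < k /\ k <= a + leaves t).
Proof. by case/tris_edges => /edges_bound ? /edges_bound ? _; lia. Qed.

Lemma edges_noncrossing t a p q p' q' :
  (p, q) \in edges a t -> (p', q') \in edges a t ->
  ~ (p < p' /\ p' < q /\ q < q').
Proof.
elim: t a => [|l IHl r IHr] a /=; rewrite !inE.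
  by move=> /eqP[-> ->] /eqP[-> ->]; lia.
have := leaves_gt0 l; have := leaves_gt0 r => gr gl.
rewrite !mem_cat => /orP[/eqP[-> ->]|/orP[] e] /orP[/eqP[-> ->]|/orP[] e'].
all: try (move/edges_bound: (e)); try (move/edges_bound: (e')).
all: try lia.
- by move=> _ _; exact: IHl e e'.
- by move=> _ _; exact: IHr e e'.
Qed.

(** A chord that passes over the apex of the root triangle must be the root chord, because it
    crosses neither lower side; any other chord belongs to one child. *)
Lemma edges_maximal t a p q : (a <= p) -> (p < q) -> (q <= a + leaves t) ->
  (forall p' q', (p', q') \in edges a t ->
     ~ (p < p' /\ p' < q /\ q < q') /\ ~ (p' < p /\ p < q' /\ q' < q)) ->
  (p, q) \in edges a t.
Proof.
elim: t a => [|l IHl r IHr] a /=.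
  by move=> ap pq qa _; rewrite inE; apply/eqP; congr pair; lia.
move=> ap pq qb nc; rewrite inE mem_cat.
have gl := leaves_gt0 l; have gr := leaves_gt0 r.
have ncl p' q' : (p', q') \in edges a l -> ~ (p < p' /\ p' < q /\ q < q') /\
    ~ (p' < p /\ p < q' /\ q' < q).
  by move=> e; apply: nc; rewrite inE mem_cat e !orbT.
have ncr p' q' : (p', q') \in edges (a + leaves l) r ->
    ~ (p < p' /\ p' < q /\ q < q') /\ ~ (p' < p /\ p < q' /\ q' < q).
  by move=> e; apply: nc; rewrite inE mem_cat e !orbT.
have [qc|cq] := leqP q (a + leaves l); first by rewrite IHl ?orbT.
have [cp|pc] := leqP (a + leaves l) p; first by rewrite IHr ?orbT// -addnA.
have [_ n1] := ncl _ _ (edges_top a l).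
have [n2 _] := ncr _ _ (edges_top (a + leaves l) r).
by apply/orP; left; apply/eqP; congr pair; lia.
Qed.

(** * Leaves of a tree of bounded height or diameter *)

Lemma leaves_le_exp_height t : (leaves t <= 2 ^ height t).
Proof.
elim: t => //= l IHl r IHr; rewrite expnS mul2n -addnn; apply: leq_add.
- by apply: leq_trans IHl _; rewrite leq_exp2l// leq_maxl.
- by apply: leq_trans IHr _; rewrite leq_exp2l// leq_maxr.
Qed.

(* Number of vertices of the largest polygon of dual diameter at most D. *)
Definition max_size D := (if odd D then 4 * 2 ^ D./2 else 3 * 2 ^ D./2).

(** The three summands are used separately: a child of height [uphalf D], a child of height
    [D - uphalf D], and a budget for all further growth above them. *)
Lemma max_size_uphalf D :
  (max_size D = 2 ^ uphalf D + 2 ^ (D - uphalf D) + 2 ^ (D - uphalf D)).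
Proof.
rewrite /max_size; have := odd_double_half D; rewrite uphalf_half.
case: (odd D) => /= DE.
- have -> : (D - (1 + D./2) = D./2) by lia.
  by rewrite add1n expnS; lia.
- have -> : (D - (0 + D./2) = D./2) by lia.
  by rewrite add0n; lia.
Qed.

(* Once a tree is higher than half the diameter, it can only grow along one
   branch, each further level adding at most half as many leaves as the previous
   one; the term 2 ^ (D.+1 - height t) is one more than the sum of all
   increments still possible. *)
Lemma leaves_high t D : (diam t <= D) -> (uphalf D < height t) ->
  (height t <= D.+1) /\ (leaves t + 2 ^ (D.+1 - height t) <= max_size D).
Proof.
elim: t => //= l IHl r IHr dD; rewrite ltnS => hD.
have dl : (diam l <= D) by lia.
have dr : (diam r <= D) by lia.
have hlr : (height l + height r <= D) by lia.
have main x y : (diam x <= D -> uphalf D < height x ->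
    (height x <= D.+1) /\ leaves x + 2 ^ (D.+1 - height x) <= max_size D) ->
  (diam x <= D) -> (height y <= height x) -> (height x + height y <= D) ->
  (uphalf D <= height x) ->
  (leaves x + leaves y + 2 ^ (D - height x) <= max_size D).
  move=> IH dx yx xyD hx.
  have hy : (leaves y <= 2 ^ (D - height x)).
    by apply: leq_trans (leaves_le_exp_height y) _; rewrite leq_exp2l//; lia.
  move: hx; rewrite leq_eqVlt => /orP[/eqP hx|hx].
    rewrite max_size_uphalf hx; have := leaves_le_exp_height x; lia.
  have [] := IH dx hx.
  have -> : (D.+1 - height x = (D - height x).+1) by lia.
  by rewrite expnS; lia.
have [rl|lr] := leqP (height r) (height l).
- split; first lia.
  by rewrite subSS; apply: main => //; lia.
- split; first lia.
  by rewrite subSS [(leaves l + _)]addnC; apply: main => //; lia.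
Qed.

Lemma leaves_lt_max_size t D : (diam t <= D) -> (leaves t < max_size D).
Proof.
move=> dD; have [hD|/(leaves_high dD)[_]] := leqP (height t) (uphalf D).
  rewrite max_size_uphalf.
  have : (2 ^ height t <= 2 ^ uphalf D) by rewrite leq_exp2l.
  have := leaves_le_exp_height t; have := expn_gt0 2 (D - uphalf D); lia.
by have := expn_gt0 2 (D.+1 - height t); lia.
Qed.

Lemma exists_low_tree h L : (0 < L <= 2 ^ h) ->
  exists t, leaves t = L /\ (height t <= h).
Proof.
elim: h L => [|h IH] L; first by move=> L1; exists Leaf; split => //=; lia.
rewrite expnS => hL; have [L1|L1] := leqP L 1.
  by exists Leaf; split => //=; lia.
have [|l [lL lh]] := IH (L./2); first lia.
have [|r [rL rh]] := IH (uphalf L); first lia.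
by exists (Node l r) => /=; split; lia.
Qed.

(** The children have height at most h - 1, whence 2h - 2 for h >= 2; truncated subtraction keeps
    the bound valid for smaller h. *)
Lemma diam_le_height t h : (height t <= h) -> (diam t <= h + (h - 2)).
Proof.
by elim: t h => //= l IHl r IHr [//|h] hh;
  have := IHl h; have := IHr h; case: l IHl hh => [|? ?] IHl /=;
  case: r IHr => [|? ?] IHr /=; lia.
Qed.

(** The construction reverses [leaves_high]: i counts the levels added above a node of height at
    most [uphalf D + 1], and the last level turns the remaining budget into 2 ^ 0. *)
Lemma exists_tree D L : (0 < L < max_size D) ->
  exists t, leaves t = L /\ (diam t <= D).
Proof.
move=> /andP[L0 LD].
suff H i : (i <= D - uphalf D) -> forall L, (0 < L) ->
    (L + 2 ^ (D - uphalf D - i) <= max_size D) ->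
    exists t, [/\ leaves t = L, diam t <= D & height t <= (uphalf D + i).+1].
  have [|t [tL tD _]] := H _ (leqnn _) L L0; last by exists t.
  by rewrite subnn addn1.
elim: i => [_|i IH iD] {LD L0}L L0 LD.
  rewrite subn0 in LD; rewrite addn0.
  have {LD} : (L <= 2 ^ uphalf D + 2 ^ (D - uphalf D)).
    by move: LD; rewrite max_size_uphalf; lia.
  have [L1 _|L1 LD] := leqP L 1; first by exists Leaf; split => //=; lia.
  (* The left child takes as many leaves as its height allows, but leaves at least one for the right
     child. *)
  pose L' := minn L.-1 (2 ^ uphalf D).
  have ? := expn_gt0 2 (uphalf D); have ? := expn_gt0 2 (D - uphalf D).
  have [|l [lL lh]] := @exists_low_tree (uphalf D) L'; first by lia.
  have [|r [rL rh]] := @exists_low_tree (D - uphalf D) (L - L'); first by lia.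
  exists (Node l r) => /=.
  have := diam_le_height lh; have := diam_le_height rh.
  have := odd_double_half D; rewrite uphalf_half in lh rh *.
  by move=> ? ? ?; split; lia.
have iD' : (i <= D - uphalf D) by lia.
have [{}LD|LD'] := leqP (L + 2 ^ (D - uphalf D - i)) (max_size D).
  by have [t [tL tD th]] := IH iD' L L0 LD; exists t; split => //; lia.
have eD : (D - uphalf D - i = (D - uphalf D - i.+1).+1) by lia.
set e := (D - uphalf D - i.+1) in LD eD.
have {}IH := IH iD'.
have e1 : (2 ^ e <= 2 ^ uphalf D).
  by rewrite leq_exp2l//; have := odd_double_half D; rewrite uphalf_half /e; lia.
rewrite eD expnS in LD'.
have e2 : (2 ^ (e.+1) <= 2 ^ (D - uphalf D)) by rewrite leq_exp2l//; lia.
rewrite expnS in e2.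
have eL : (2 ^ e < L) by move: LD'; rewrite max_size_uphalf; lia.
(* The new root joins a tree of height at most [uphalf D + i + 1] to a full tree of height at most
   [e]; these heights add up to D. *)
have [||l [lL ld lh]] := IH (L - 2 ^ e); first lia.
  by rewrite eD expnS; lia.
have ? := expn_gt0 2 e.
have [|r [rL rh]] := @exists_low_tree e (2 ^ e); first by lia.
exists (Node l r) => /=; have := diam_le_height rh.
move=> ?; have De := odd_double_half D; rewrite /e uphalf_half in lh rh *.
move: LD'; rewrite max_size_uphalf => LD'.
by split; lia.
Qed.

(** The corners i, j, k cut the boundary into three arcs, and a chord that crosses no side of the
    triangle has both ends on one of them. The case p = q stands for a single vertex. *)
Lemma noncrossing_arc i j k p q : i < j -> j < k -> p <= q ->
  ~ (i < p /\ p < j /\ j < q) -> ~ (p < i /\ i < q /\ q < j) ->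
  ~ (j < p /\ p < k /\ k < q) -> ~ (p < j /\ j < q /\ q < k) ->
  ~ (i < p /\ p < k /\ k < q) -> ~ (p < i /\ i < q /\ q < k) ->
  [|| (i <= p) && (q <= j), (j <= p) && (q <= k) |
      ((p <= i) || (k <= p)) && ((q <= i) || (k <= q))].
Proof. by lia. Qed.

(** * Chords separating two triangles of a tree *)

Definition inside (e : nat * nat) (u : nat * nat * nat) :=
  (e.1 <= u.1.1) && (u.2 <= e.2).

Definition outside (e : nat * nat) (u : nat * nat * nat) :=
  [&& (u.1.1 <= e.1) || (e.2 <= u.1.1), (u.1.2 <= e.1) || (e.2 <= u.1.2)
    & (u.2 <= e.1) || (e.2 <= u.2)].

(** [S] collects the chords above the triangles of a longest branch, from the root chord down to the
    long side of the deepest triangle [u]. *)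
Lemma exists_deep_triangle t a : t <> Leaf ->
  exists u S, [/\ u \in tris a t, uniq S, size S = height t,
    {subset S <= edges a t} & forall e, e \in S -> inside e u].
Proof.
elim: t a => [//|l IHl r IHr] a _.
have gl := leaves_gt0 l; have gr := leaves_gt0 r.
have step x b : x <> Leaf -> {subset tris b x <= tris a (Node l r)} ->
    {subset edges b x <= edges a (Node l r)} ->
    (a <= b) -> (b + leaves x <= a + leaves (Node l r)) ->
    (leaves x < leaves (Node l r)) ->
    height (Node l r) = (height x).+1 ->
    (x <> Leaf -> exists u S, [/\ u \in tris b x, uniq S, size S = height x,
    {subset S <= edges b x} & forall e, e \in S -> inside e u]) ->
    exists u S, [/\ u \in tris a (Node l r), uniq S, size S = height (Node l r),
    {subset S <= edges a (Node l r)} & forall e, e \in S -> inside e u].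
  move=> xL tx ex ab ba lx hx /(_ xL)[[[i j] k] [S [uT uS sS SE Su]]].
  exists (i, j, k), ((a, a + leaves (Node l r)) :: S); split.
  - exact: tx.
  - rewrite cons_uniq uS andbT; apply/negP => /SE /edges_bound; lia.
  - by rewrite hx -sS.
  - by move=> e; rewrite inE => /orP[/eqP->|/SE/ex//]; exact: edges_top.
  - move=> e; rewrite inE => /orP[/eqP->|/Su//].
    by have /tris_bound := uT; move: ba; rewrite /inside /=; lia.
have [hh|hh] := leqP (height r) (height l).
  have [lL|lL] := pselect (l = Leaf).
    have rL : r = Leaf by move: hh; rewrite lL; case: (r).
    rewrite lL rL; exists (a, a + 1, a + 2), [:: (a, a + 2)]; split => //=.
    - by rewrite inE eqxx.
    - by move=> e; rewrite !inE => ->.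
    - by move=> e; rewrite inE => /eqP ->; rewrite /inside/=; lia.
  apply: (step l a) => //=; try lia; last exact: IHl.
  - by move=> u; rewrite inE mem_cat => ->; rewrite orbT.
  - by move=> u; rewrite inE mem_cat => ->; rewrite orbT.
have rL : r <> Leaf by move=> rL; move: hh; rewrite rL.
apply: (step r (a + leaves l)) => //=; try lia; last exact: IHr.
- by move=> u; rewrite inE mem_cat => ->; rewrite !orbT.
- by move=> u; rewrite inE mem_cat => ->; rewrite !orbT.
Qed.

(** On a longest path from [u] to [v], [S1] holds the chords crossed while climbing to the common
    ancestor and [S2] those crossed while descending from it. *)
Lemma exists_separated_triangles t a : t <> Leaf ->
  exists u v S1 S2,
    [/\ u \in tris a t, v \in tris a t, uniq S1, uniq S2
      & (size S1 + size S2) = diam t] /\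
    [/\ {subset S1 <= edges a t}, {subset S2 <= edges a t},
        forall e, e \in S1 -> inside e u && outside e v
      & forall e, e \in S2 -> outside e u && inside e v].
Proof.
elim: t a => [//|l IHl r IHr] a _.
have gl := leaves_gt0 l; have gr := leaves_gt0 r.
have stl : {subset tris a l <= tris a (Node l r)}.
  by move=> u; rewrite inE mem_cat => ->; rewrite orbT.
have str : {subset tris (a + leaves l) r <= tris a (Node l r)}.
  by move=> u; rewrite inE mem_cat => ->; rewrite !orbT.
have sel : {subset edges a l <= edges a (Node l r)}.
  by move=> u; rewrite inE mem_cat => ->; rewrite orbT.
have ser : {subset edges (a + leaves l) r <= edges a (Node l r)}.
  by move=> u; rewrite inE mem_cat => ->; rewrite !orbT.
have low : exists u S, [/\ u \in tris a (Node l r), uniq S, size S = height l,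
    {subset S <= edges a l} & forall e, e \in S -> inside e u] /\
    forall e, e \in edges (a + leaves l) r -> outside e u.
  (* Below a leaf there is no triangle; the root triangle then serves as the end of the path, with
     no chord to cross. *)
  have [->|/(@exists_deep_triangle l a)] := pselect (l = Leaf).
    exists (a, a + leaves Leaf, a + leaves (Node Leaf r)), [::]; split.
      by split => //; rewrite inE eqxx.
    by move=> [p q] /edges_bound /=; rewrite /outside /=; lia.
  case=> -[[i j] k] [S [uT uS sS SE Su]]; exists (i, j, k), S; split.
    by split => //; exact: stl.
  move=> [p q] /edges_bound; have := tris_bound uT; rewrite /outside /=; lia.
have high : exists u S, [/\ u \in tris a (Node l r), uniq S, size S = height r,
    {subset S <= edges (a + leaves l) r} & forall e, e \in S -> inside e u] /\
    forall e, e \in edges a l -> outside e u.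
  have [->|/(@exists_deep_triangle r (a + leaves l))] := pselect (r = Leaf).
    exists (a, a + leaves l, a + leaves (Node l Leaf)), [::]; split.
      by split => //; rewrite inE eqxx.
    by move=> [p q] /edges_bound /=; rewrite /outside /=; lia.
  case=> -[[i j] k] [S [uT uS sS SE Su]]; exists (i, j, k), S; split.
    by split => //; exact: str.
  move=> [p q] /edges_bound; have := tris_bound uT; rewrite /outside /=; lia.
case: low => u [S1 [[uT uS1 sS1 S1E S1u] uo]].
case: high => v [S2 [[vT uS2 sS2 S2E S2v] vo]].
have [dl|dl] := leqP (maxn (diam l) (diam r)) (height l + height r).
  exists u, v, S1, S2; split; first by split => //=; rewrite sS1 sS2; lia.
  split.
  - by move=> e /S1E/sel.
  - by move=> e /S2E/ser.
  - by move=> e eS; rewrite S1u// vo// S1E.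
  - by move=> e eS; rewrite S2v// uo ?S2E.
have [rl|lr] := leqP (diam r) (diam l).
  have lL : l <> Leaf by move=> lL; move: dl rl; rewrite lL /= max0n; lia.
  have [u' [v' [T1 [T2 [[? ? ? ? Tl] [T1E T2E ? ?]]]]]] := IHl a lL.
  exists u', v', T1, T2; split.
    by split => //=; [exact: stl|exact: stl|rewrite Tl; lia].
  by split => //; [move=> e /T1E/sel|move=> e /T2E/sel].
have rL : r <> Leaf by move=> rL; move: dl lr; rewrite rL /= maxn0; lia.
have [u' [v' [T1 [T2 [[? ? ? ? Tl] [T1E T2E ? ?]]]]]] := IHr (a + leaves l) rL.
exists u', v', T1, T2; split.
  by split => //=; [exact: str|exact: str|rewrite Tl; lia].
by split => //; [move=> e /T1E/ser|move=> e /T2E/ser].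
Qed.

(** * Walks along the tree, in any graph where parent and child are adjacent *)

Definition parent (u u' : nat * nat * nat) :=
  (u'.1.1, u'.2) = u.1 \/ (u'.1.1, u'.2) = (u.1.2, u.2).

Section Walks.
Variables (V : Type) (adj : V -> V -> Prop).
Hypothesis adjC : forall x y, adj x y -> adj y x.

Lemma walk_cat j k x y z : walk adj j x y -> walk adj k y z ->
  walk adj (j + k) x z.
Proof.
elim: j x => [|j IH] x /=; first by move=> ->.
by move=> [w [xw wy]] yz; exists w; split => //; exact: IH.
Qed.

Lemma walk_rev k x y : walk adj k x y -> walk adj k y x.
Proof.
elim: k x => [//|k IH] x [z [xz /IH zy]].
by rewrite -addn1; apply: walk_cat zy _; exists x; split => //; exact: adjC.
Qed.

Variables (f : nat * nat * nat -> V).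

Lemma walk_to_root t a u :
  (forall u u', u \in tris a t -> u' \in tris a t -> parent u u' ->
     adj (f u) (f u')) ->
  u \in tris a t ->
  exists j k, (k < height t) /\ walk adj k (f (a, j, (a + leaves t))) (f u) /\
    (a, j, (a + leaves t)) \in tris a t.
Proof.
elim: t a => [//|l IHl r IHr] a padj.
have rootT : (a, a + leaves l, a + leaves (Node l r)) \in tris a (Node l r).
  by rewrite inE eqxx.
move=> uT; exists (a + leaves l); move: uT.
rewrite inE mem_cat => /orP[/eqP ->|/orP[] uT]; first by exists 0.
- have [|j [k [kh [uw jT]]]] := IHl a _ uT.
    by move=> v v' vT vT'; apply: padj; rewrite inE mem_cat ?vT ?vT' orbT.
  exists k.+1; split; first by move=> /=; lia.
  split; last exact: rootT.
  exists (f (a, j, (a + leaves l))); split => //; apply: padj => //.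
    by rewrite inE mem_cat jT orbT.
  by left.
- have [|j [k [kh [uw jT]]]] := IHr (a + leaves l) _ uT.
    by move=> v v' vT vT'; apply: padj; rewrite inE mem_cat ?vT ?vT' !orbT.
  exists k.+1; split; first by move=> /=; lia.
  split; last exact: rootT.
  exists (f ((a + leaves l), j, (a + leaves l + leaves r))).
  split => //; apply: padj => //; first by rewrite inE mem_cat jT !orbT.
  by right; rewrite /= addnA.
Qed.

Lemma walk_diam t a u v :
  (forall u u', u \in tris a t -> u' \in tris a t -> parent u u' ->
     adj (f u) (f u')) ->
  u \in tris a t -> v \in tris a t ->
  exists2 k, (k <= diam t) & walk adj k (f u) (f v).
Proof.
elim: t a u v => [//|l IHl r IHr] a u v padj uT vT.
have rootT : (a, a + leaves l, a + leaves (Node l r)) \in tris a (Node l r).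
  by rewrite inE eqxx.
have padjl w w' : w \in tris a l -> w' \in tris a l -> parent w w' ->
    adj (f w) (f w').
  by move=> wT wT'; apply: padj; rewrite inE mem_cat ?wT ?wT' !orbT.
have padjr w w' : w \in tris (a + leaves l) r -> w' \in tris (a + leaves l) r ->
    parent w w' -> adj (f w) (f w').
  by move=> wT wT'; apply: padj; rewrite inE mem_cat ?wT ?wT' !orbT.
pose rt := f (a, a + leaves l, a + leaves (Node l r)).
have to_root w : w \in tris a (Node l r) ->
  [\/ w = (a, a + leaves l, a + leaves (Node l r)),
      w \in tris a l /\ exists2 k, (k <= height l) & walk adj k rt (f w) |
      w \in tris (a + leaves l) r /\
        exists2 k, (k <= height r) & walk adj k rt (f w)].
  rewrite inE mem_cat => /orP[/eqP ->|/orP[] wT]; first by constructor 1.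
  - constructor 2; split => //.
    have [j [k [kh [uw jT]]]] := walk_to_root padjl wT.
    exists k.+1; first by move=> /=; lia.
    exists (f (a, j, (a + leaves l))); split => //; apply: padj => //.
      by rewrite inE mem_cat jT orbT.
    by left.
  - constructor 3; split => //.
    have [j [k [kh [uw jT]]]] := walk_to_root padjr wT.
    exists k.+1; first by move=> /=; lia.
    exists (f ((a + leaves l), j, (a + leaves l + leaves r))).
    split => //; apply: padj => //; first by rewrite inE mem_cat jT !orbT.
    by right; rewrite /= addnA.
case: (to_root u uT) => [->|[uT' [j jh ju]]|[uT' [j jh ju]]];
  case: (to_root v vT) => [->|[vT' [k kh kv]]|[vT' [k kh kv]]].
- by exists 0.
- by exists k => //=; lia.
- by exists k => //=; lia.
- by exists j; [move=> /=; lia|exact: walk_rev].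
- by have [m md mw] := IHl a u v padjl uT' vT'; exists m => //=; lia.
- exists (j + k); first by move=> /=; lia.
  exact: walk_cat (walk_rev ju) kv.
- by exists j; [move=> /=; lia|exact: walk_rev].
- exists (j + k); first by move=> /=; lia.
  exact: walk_cat (walk_rev ju) kv.
- by have [m md mw] := IHr _ u v padjr uT' vT'; exists m => //=; lia.
Qed.

End Walks.

(** Induction on the length of the chord: a chord that is not a side is split at the apex of the
    triangle it carries. *)
Lemma exists_subtree (E : nat -> nat -> Prop) n :
  (forall i, i.+1 < n -> E i i.+1) ->
  (forall i j, (i.+1 < j < n) -> E i j -> exists2 k, (i < k < j) & E i k /\ E k j) ->
  forall a b, (a < b < n) -> E a b ->
  exists t, (a + leaves t = b) /\ forall p q, (p, q) \in edges a t -> E p q.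
Proof.
move=> side apex a b; move: {2}(b - a) (leqnn (b - a)) => d.
elim: d a b => [a b|d IH a b ba ab Eab]; first by lia.
have [ab1|ab1] := leqP b a.+1.
  exists Leaf; split => /=; first lia.
  by move=> p q; rewrite inE addn1 => /eqP[-> ->]; apply: side; lia.
have [|k kab [Eak Ekb]] := apex _ _ _ Eab; first lia.
have [||//|l [la lE]] := IH a k; try lia.
have [||//|r [rk rE]] := IH k b; try lia.
exists (Node l r) => /=; split; first lia.
move=> p q; rewrite inE mem_cat => /orP[/eqP[-> ->]|/orP[/lE//|]].
  by rewrite [(a + _)](_ : _ = b)//; lia.
by rewrite la; exact: rE.
Qed.

Local Open Scope classical_set_scope.
Local Open Scope ring_scope.

(** * Orientation and convex position *)

Section Plane.
Variable R : realType.
Local Notation plane := (R * R)%type.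
Implicit Types a b c d p q x y : plane.

(** Twice the signed area of the triangle, positive when a, b, c turn counterclockwise; in c it is
    an affine function vanishing on the line through a and b. *)
Definition det a b c : R :=
  (b.1 - a.1) * (c.2 - a.2) - (b.2 - a.2) * (c.1 - a.1).

Lemma detC a b x : det b a x = - det a b x.
Proof. by rewrite /det; ring. Qed.

Lemma det_rot a b c : det b c a = det a b c.
Proof. by rewrite /det; ring. Qed.

Lemma detll a b : det a b a = 0.
Proof. by rewrite /det; ring. Qed.

Lemma detlr a b : det a b b = 0.
Proof. by rewrite /det; ring. Qed.

Lemma det_mix a b x y (t : R) :
  det a b ((1 - t) *: x + t *: y) = (1 - t) * det a b x + t * det a b y.
Proof.
rewrite /det; have -> : ((1 - t) *: x + t *: y).1 = (1 - t) * x.1 + t * y.1 by [].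
by have -> : ((1 - t) *: x + t *: y).2 = (1 - t) * x.2 + t * y.2 by []; ring.
Qed.

(** The affine function [det p q] evaluated through the barycentric coordinates of x, with
    denominators cleared. *)
Lemma det_barycentric a b c p q x :
  det p q x * det a b c =
  det p q a * det b c x + det p q b * det c a x + det p q c * det a b x.
Proof. by rewrite /det; ring. Qed.

Lemma det_total a b c x : det a b x + det b c x + det c a x = det a b c.
Proof. by rewrite /det; ring. Qed.

Lemma plane_eq x y : x.1 = y.1 -> x.2 = y.2 -> x = y.
Proof. by case: x y => [? ?] [? ?] /= -> ->. Qed.

Lemma mix_eq x y z (t : R) :
  x.1 = (1 - t) * y.1 + t * z.1 -> x.2 = (1 - t) * y.2 + t * z.2 ->
  x = (1 - t) *: y + t *: z.
Proof. by move=> h1 h2; apply: plane_eq. Qed.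

Lemma mix_fst y z (t : R) :
  ((1 - t) *: y + t *: z).1 = (1 - t) * y.1 + t * z.1.
Proof. by []. Qed.

Lemma mix_snd y z (t : R) :
  ((1 - t) *: y + t *: z).2 = (1 - t) * y.2 + t * z.2.
Proof. by []. Qed.

Lemma det_eq0_mix a b c : a <> b -> det a b c = 0 ->
  exists t : R, c = (1 - t) *: a + t *: b.
Proof.
move=> ab abc; have [e1|e1] := eqVneq b.1 a.1; last first.
  have e : b.1 - a.1 != 0 by rewrite subr_eq0.
  exists ((c.1 - a.1) / (b.1 - a.1)); apply: mix_eq; first by field.
  apply: (mulfI e); move: abc; rewrite /det => abc.
  have -> : (b.1 - a.1) * c.2 =
    (b.1 - a.1) * a.2 + (b.2 - a.2) * (c.1 - a.1) by lra.
  by field.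
have e : b.2 - a.2 != 0.
  by rewrite subr_eq0; apply/eqP => e2; apply: ab; apply: plane_eq.
exists ((c.2 - a.2) / (b.2 - a.2)); apply: mix_eq; last by field.
apply: (mulfI e); move: abc; rewrite /det e1 => abc.
have -> : (b.2 - a.2) * c.1 = (b.2 - a.2) * a.1 by lra.
by field.
Qed.

Lemma convex_mix (B : set plane) x y (t : R) :
  @convex_set R plane B -> B x -> B y -> 0 <= t <= 1 ->
  B ((1 - t) *: x + t *: y).
Proof.
move=> cB Bx By /andP[t0 t1].
have t01 : (0 <= 1 - t <= 1) by rewrite subr_ge0 t1 gerBl.
have := cB x y (Itv01 (andP t01).1 (andP t01).2) (mem_set Bx) (mem_set By).
by move=> /set_mem; rewrite /conv /= /unstable.onem subKr.
Qed.

Lemma convex_triangle (B : set plane) a b c x :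
  @convex_set R plane B -> B a -> B b -> B c ->
  0 < det a b x -> 0 < det b c x -> 0 < det c a x -> B x.
Proof.
move=> cB Ba Bb Bc x1 x2 x3.
have e := det_total a b c x.
(* The weights of a, b, c are proportional to [det b c x], [det c a x], [det a b x]: s is the share
   of c against b, and t is the joint share of b and c. *)
set s := det a b x / (det a b x + det c a x).
set t := (det a b x + det c a x) / det a b c.
suff -> : x = (1 - t) *: a + t *: ((1 - s) *: b + s *: c).
  have s01 : 0 <= s <= 1.
    by rewrite divr_ge0 ?ler_pdivrMr//=; lra.
  have t01 : 0 <= t <= 1.
    by rewrite divr_ge0 ?ler_pdivrMr//=; lra.
  by apply: convex_mix => //; exact: convex_mix.
have n1 : det a b x + det c a x != 0 by rewrite gt_eqF//; lra.
have n2 : det a b c != 0 by rewrite gt_eqF//; lra.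
have E (u v w X : R) : det a b c * X = det b c x * u + det c a x * v + det a b x * w ->
   X = (1 - t) * u + t * ((1 - s) * v + s * w).
  move=> h; apply: (mulfI n2); rewrite h /t /s.
  have -> : det b c x = det a b c - det a b x - det c a x by lra.
  by field; rewrite n1 n2.
by apply: mix_eq; rewrite ?mix_fst ?mix_snd; apply: E; rewrite /det; ring.
Qed.

Section ConvexPosition.
Variables (n : nat) (v : 'I_n -> plane).
Hypothesis hv : forall i, ~ conv_hull [set v j | j in [set j | j != i]] (v i).

Lemma vertex_not_mix i j k (t : R) : j != i -> k != i -> 0 <= t <= 1 ->
  v i <> (1 - t) *: v j + t *: v k.
Proof.
move=> ji ki t01 e; apply: (@hv i) => B [cB AB]; rewrite e.
by apply: convex_mix => //; apply: AB; [exists j|exists k].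
Qed.

Lemma vertex_inj i j : v i = v j -> i = j.
Proof.
move=> vij; apply/eqP/negPn/negP => ij.
have ji : j != i by rewrite eq_sym.
apply: (@vertex_not_mix i j j 0 ji ji); first by rewrite lexx ler01.
by rewrite subr0 scale1r scale0r addr0.
Qed.

Lemma vertex_not_triangle i j k l : l != i -> l != j -> l != k ->
  0 < det (v i) (v j) (v l) -> 0 < det (v j) (v k) (v l) ->
  0 < det (v k) (v i) (v l) -> False.
Proof.
move=> li lj lk d1 d2 d3; apply: (@hv l) => B [cB AB].
by apply: (convex_triangle cB _ _ _ d1 d2 d3); apply: AB;
  [exists i|exists j|exists k] => //=; rewrite eq_sym.
Qed.

(** Of three collinear points one lies between the other two; comparing t with 0 and 1 tells which,
    and no vertex may lie there. *)
Lemma vertex_det_neq0 i j k : i != j -> j != k -> i != k ->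
  det (v i) (v j) (v k) != 0.
Proof.
move=> ij jk ik; apply/eqP => d0.
have vij : v i <> v j by move/vertex_inj/eqP; rewrite (negPf ij).
have [t e] := det_eq0_mix vij d0.
have [t0|t0] := ltP t 0.
  have t1 : 1 - t != 0 by rewrite gt_eqF//; lra.
  apply: (@vertex_not_mix i j k (1 - t)^-1); rewrite 1?eq_sym//.
    by rewrite invr_ge0 invf_le1; lra.
  by rewrite e; apply: mix_eq; rewrite ?mix_fst ?mix_snd; field.
have [t1|t1] := leP t 1.
  by apply: (@vertex_not_mix k i j t) => //; rewrite t0.
have t1' : t != 0 by rewrite gt_eqF//; lra.
apply: (@vertex_not_mix j i k t^-1); rewrite 1?eq_sym//.
  by rewrite eq_sym.
  by rewrite invr_ge0 invf_le1; lra.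
by rewrite e; apply: mix_eq; rewrite ?mix_fst ?mix_snd; field.
Qed.

End ConvexPosition.

Definition ccw (n : nat) (w : nat -> plane) :=
  forall i j k, (i < j)%N -> (j < k)%N -> (k < n)%N ->
    0 < det (w i) (w j) (w k).

(* Around a vertex v i0 the relation "0 < det (v i0) (v i) (v j)" is
   transitive, since v i0 is not inside a triangle of vertices. *)
Lemma exists_ccw_order n (v : 'I_n -> plane) (i0 : 'I_n) :
  (forall i, ~ conv_hull [set v j | j in [set j | j != i]] (v i)) ->
  exists s : nat -> 'I_n, exists r : 'I_n -> nat,
    [/\ forall i, s (r i) = i, forall i, (r i < n)%N,
        forall k, (k < n)%N -> r (s k) = k & ccw n (fun k => v (s k))].
Proof.
move=> hv.
pose lt i j := 0 < det (v i0) (v i) (v j).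
pose le i j := (i == j) || lt i j.
pose oth := [seq i <- enum 'I_n | i != i0].
pose P : pred 'I_n := fun i => i != i0.
have allP : all P oth by apply/allP => i; rewrite mem_filter => /andP[].
have le_total : {in P &, total le}.
  move=> i j; rewrite !unfold_in => Pi Pj; rewrite /le /lt.
  have [//|ij /=] := eqVneq i j.
  have := @vertex_det_neq0 _ _ hv i0 i j; rewrite eq_sym Pi ij eq_sym Pj.
  have -> : det (v i0) (v j) (v i) = - det (v i0) (v i) (v j).
    by rewrite /det; ring.
  rewrite oppr_gt0 => /(_ isT isT isT); rewrite neq_lt => /orP[] ->//.
  by rewrite orbT.
have le_trans : {in P & &, transitive le}.
  move=> j i k; rewrite !unfold_in => Pj Pi Pk; rewrite /le /lt.
  move=> /orP[/eqP->//|ij] /orP[/eqP<-|jk]; first by rewrite ij orbT.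
  have [//|ik /=] := eqVneq i k.
  have := @vertex_det_neq0 _ _ hv i0 i k; rewrite eq_sym Pi ik eq_sym Pk.
  move=> /(_ isT isT isT); rewrite neq_lt => /orP[ki|//]; exfalso.
  apply: (@vertex_not_triangle _ _ hv i j k i0); rewrite 1?eq_sym//.
  - by rewrite -det_rot -det_rot.
  - by rewrite -det_rot -det_rot.
  - by rewrite -det_rot -det_rot /det; move: ki; rewrite /det; lra.
pose q := i0 :: sort le oth.
have uq : uniq q.
  by rewrite /= mem_sort mem_filter eqxx /= sort_uniq filter_uniq// enum_uniq.
have mq i : i \in q.
  by rewrite inE mem_sort mem_filter mem_enum andbT orbN.
have szq : size q = n.
  rewrite -[RHS](card_ord n) cardE; apply/perm_size/uniq_perm => //.
    exact: enum_uniq.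
  by move=> i; rewrite mq mem_enum.
have allPs : all P (sort le oth) by rewrite all_sort.
have /(pairwiseP i0) pw : pairwise le (sort le oth).
  by rewrite -(sorted_pairwise_in le_trans)// (sort_sorted_in le_total).
have ltq i j : (0 < i -> i < j -> j < n -> lt (nth i0 q i) (nth i0 q j))%N.
  case: i j => [//|i] [//|j] _; rewrite ltnS => ij jn.
  have szs : (j < size (sort le oth))%N by have : (j.+1 < size q)%N by rewrite szq.
  have := pw i j; rewrite !unfold_in /= => /(_ (ltn_trans ij szs) szs ij).
  have : nth i0 (sort le oth) i != nth i0 (sort le oth) j.
    rewrite nth_uniq//; first by rewrite ltn_eqF.
    - exact: ltn_trans ij szs.
    - by case/andP: uq.
  by rewrite /le => /negPf ->.
exists (nth i0 q), (index^~ q); split.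
- by move=> i; rewrite nth_index.
- by move=> i; rewrite -[X in (_ < X)%N]szq index_mem.
- by move=> k kn; rewrite index_uniq// szq.
move=> i j k ij jk kn.
have [i0'|i0'] := posnP i; first by rewrite i0' /= -/(lt _ _); apply: ltq => //; lia.
have d1 : lt (nth i0 q i) (nth i0 q j) by apply: ltq => //; lia.
have d2 : lt (nth i0 q j) (nth i0 q k) by apply: ltq => //; lia.
have d3 : lt (nth i0 q i) (nth i0 q k) by apply: ltq => //; lia.
have neq e f : (e < f -> f < n -> nth i0 q e != nth i0 q f)%N.
  by move=> ef fn; rewrite nth_uniq ?szq//; lia.
(* If this triple turned clockwise, its middle vertex would lie inside the triangle formed by [v i0]
   and the other two. *)
have := @vertex_det_neq0 _ _ hv (nth i0 q i) (nth i0 q j) (nth i0 q k).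
rewrite !neq//; try lia.
move=> /(_ isT isT isT); rewrite neq_lt => /orP[neg|//]; exfalso.
apply: (@vertex_not_triangle _ _ hv i0 (nth i0 q i) (nth i0 q k) (nth i0 q j)).
- by rewrite eq_sym -[i0]/(nth i0 q 0) neq//; lia.
- by rewrite eq_sym neq//; lia.
- by rewrite neq//; lia.
- exact: d1.
- by move: neg; rewrite /det; lra.
- by rewrite det_rot det_rot.
Qed.

End Plane.

(** * Position of vertices, faces and chords relative to a chord *)

Section Signs.
Variables (R : realType) (n : nat) (w : nat -> R * R).
Local Notation plane := (R * R)%type.
Hypothesis hw : ccw n w.

Lemma det_between p i q : (p < i)%N -> (i < q)%N -> (q < n)%N ->
  det (w p) (w q) (w i) < 0.
Proof.
by move=> pi iq qn; rewrite -det_rot -det_rot detC oppr_lt0 hw.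
Qed.

Lemma det_beyond p q i : (p < q)%N -> (q < n)%N -> (i < n)%N ->
  (i < p)%N || (q < i)%N -> 0 < det (w p) (w q) (w i).
Proof.
move=> pq qn i_n /orP[ip|qi]; last exact: hw.
by rewrite det_rot hw.
Qed.

Lemma det_between_le0 p i q : (p <= i)%N -> (i <= q)%N -> (q < n)%N ->
  det (w p) (w q) (w i) <= 0.
Proof.
rewrite leq_eqVlt => /orP[/eqP ->|pi]; first by rewrite detll.
rewrite leq_eqVlt => /orP[/eqP ->|iq]; first by rewrite detlr.
by move=> qn; apply/ltW/det_between.
Qed.

Lemma det_beyond_ge0 p q i : (p < q)%N -> (q < n)%N -> (i < n)%N ->
  (i <= p)%N || (q <= i)%N -> 0 <= det (w p) (w q) (w i).
Proof.
move=> pq qn i_n h.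
have [->|ip] := eqVneq i p; first by rewrite detll.
have [->|iq] := eqVneq i q; first by rewrite detlr.
by apply/ltW/det_beyond => //; lia.
Qed.

Lemma det_vertex_eq0 p q i : (p < q)%N -> (q < n)%N -> (i < n)%N ->
  det (w p) (w q) (w i) = 0 -> i = p \/ i = q.
Proof.
move=> pq qn i_n d0.
have [|pi] := leqP i p.
  rewrite leq_eqVlt => /orP[/eqP|ip]; first by left.
  by have := @det_beyond p q i pq qn i_n; rewrite ip d0 ltxx => /(_ isT).
have [|iq] := leqP q i.
  rewrite leq_eqVlt => /orP[/eqP|qi]; first by right.
  by have := @det_beyond p q i pq qn i_n; rewrite qi orbT d0 ltxx => /(_ isT).
by have := det_between pi iq qn; rewrite d0 ltxx.
Qed.

Definition open_triangle (a b c : plane) : set plane :=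
  [set x | [/\ 0 < det a b x, 0 < det b c x & 0 < det c a x]].

Definition face (u : nat * nat * nat) : set plane :=
  open_triangle (w u.1.1) (w u.1.2) (w u.2).

(** By [det_barycentric] the sign at x is a positive combination of the signs at the corners; it is
    strict because j lies strictly between p and q. *)
Lemma face_inside i j k p q x : (i < j)%N -> (j < k)%N -> (q < n)%N ->
  inside (p, q) (i, j, k) -> face (i, j, k) x -> det (w p) (w q) x < 0.
Proof.
move=> ij jk qn /andP[/= pi kq] [x1 x2 x3].
have d0 : 0 < det (w i) (w j) (w k) by apply: hw => //; lia.
rewrite -(pmulr_llt0 _ d0) det_barycentric.
have d1 : det (w p) (w q) (w i) <= 0 by apply: det_between_le0 => //; lia.
have d2 : det (w p) (w q) (w j) < 0 by apply: det_between => //; lia.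
have d3 : det (w p) (w q) (w k) <= 0 by apply: det_between_le0 => //; lia.
have := mulr_le0_ge0 d1 (ltW x2); have := mulr_le0_ge0 d3 (ltW x1).
have : det (w p) (w q) (w j) * det (w k) (w i) x < 0 by rewrite pmulr_llt0.
by lra.
Qed.

Lemma face_outside i j k p q x : (i < j)%N -> (j < k)%N -> (k < n)%N ->
  (p < q)%N -> (q < n)%N ->
  outside (p, q) (i, j, k) -> face (i, j, k) x -> 0 < det (w p) (w q) x.
Proof.
move=> ij jk kn pq qn /and3P[/= ipq jpq kpq] [x1 x2 x3].
have jn := ltn_trans jk kn; have i_n := ltn_trans ij jn.
rewrite -(pmulr_lgt0 _ (hw ij jk kn)) det_barycentric.
have d1 := det_beyond_ge0 pq qn i_n ipq.
have d2 := det_beyond_ge0 pq qn jn jpq.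
have d3 := det_beyond_ge0 pq qn kn kpq.
have h1 := mulr_ge0 d1 (ltW x2); have h3 := mulr_ge0 d3 (ltW x1).
have h2 := mulr_ge0 d2 (ltW x3).
(* The corner strictly beyond the chord is i when j <= p and k when q <= j. *)
case/orP: jpq => h.
- have : 0 < det (w p) (w q) (w i) * det (w j) (w k) x.
    by rewrite mulr_gt0// det_beyond// (leq_trans ij h).
  by lra.
- have : 0 < det (w p) (w q) (w k) * det (w i) (w j) x.
    by rewrite mulr_gt0// det_beyond// (leq_ltn_trans h jk) orbT.
  by lra.
Qed.

Lemma chords_cross p i q j : (p < i)%N -> (i < q)%N -> (q < j)%N -> (j < n)%N ->
  exists x, open_segm (w p) (w q) x /\ open_segm (w i) (w j) x.
Proof.
move=> pi iq qj jn.
have d1 : 0 < det (w p) (w i) (w q) by apply: hw => //; lia.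
have d2 : 0 < det (w p) (w i) (w j) by apply: hw => //; lia.
have d3 : 0 < det (w p) (w q) (w j) by apply: hw => //; lia.
have d4 : 0 < det (w i) (w q) (w j) by apply: hw => //; lia.
(* The crossing point divides each chord in the ratio of the distances of its ends from the other
   chord. *)
set s := det (w p) (w i) (w j) / (det (w p) (w i) (w j) + det (w i) (w q) (w j)).
set t := det (w p) (w i) (w q) / (det (w p) (w i) (w q) + det (w p) (w q) (w j)).
have p1 := addr_gt0 d2 d4.
have n1 : det (w p) (w i) (w j) + det (w i) (w q) (w j) != 0 by rewrite gt_eqF.
have p2 := addr_gt0 d1 d3.
have n2 : det (w p) (w i) (w q) + det (w p) (w q) (w j) != 0 by rewrite gt_eqF.
have s0 : 0 < s := divr_gt0 d2 p1.
have t0 : 0 < t := divr_gt0 d1 p2.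
have s1 : s < 1 by rewrite /s ltr_pdivrMr// mul1r ltrDl.
have t1 : t < 1 by rewrite /t ltr_pdivrMr// mul1r ltrDl.
exists ((1 - s) *: w p + s *: w q); split.
  by exists s => //=; rewrite in_itv/= s0.
exists t => /=; first by rewrite in_itv/= t0.
apply/esym/mix_eq; rewrite ?mix_fst ?mix_snd /s /t;
  move: n1 n2; rewrite /det => n1 n2; field; exact: n2.
Qed.

Lemma mix_eq0 (t A B : R) : 0 < t -> t < 1 -> 0 <= A -> 0 <= B ->
  (1 - t) * A + t * B = 0 -> A = 0 /\ B = 0.
Proof.
move=> t0 t1 A0 B0.
have u0 : 0 < 1 - t by rewrite subr_gt0.
move/eqP; rewrite paddr_eq0; [|exact: mulr_ge0 (ltW u0) A0|exact: mulr_ge0 (ltW t0) B0].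
by rewrite !mulf_eq0 (gt_eqF u0) (gt_eqF t0) => /andP[/eqP -> /eqP ->].
Qed.

(** Both ends of the second chord lie weakly on one side of the line of the first. A common interior
    point would force both onto that line, which meets the vertices only in p and q. *)
Lemma chords_disjoint p q i j : (p < q)%N -> (q < n)%N -> (i < j)%N -> (j < n)%N ->
  (p, q) <> (i, j) -> ~ (p < i /\ i < q /\ q < j)%N -> ~ (i < p /\ p < j /\ j < q)%N ->
  open_segm (w p) (w q) `&` open_segm (w i) (w j) = set0.
Proof.
move=> pq qn ij jn pqij nc1 nc2; rewrite -subset0 => x [[s _ xs] [t /= + xt]].
rewrite in_itv/= => /andP[t0 t1].
have : det (w p) (w q) x = 0 by rewrite -xs det_mix detll detlr !mulr0 addr0.
have nz : det (w p) (w q) (w i) = 0 -> det (w p) (w q) (w j) = 0 -> False.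
  move=> /(det_vertex_eq0 pq qn (ltn_trans ij jn)) hi.
  move=> /(det_vertex_eq0 pq qn jn) hj; apply: pqij; congr pair; lia.
rewrite -xt det_mix.
have [pin|] := boolP ((p <= i) && (j <= q))%N; last rewrite negb_and -!ltnNge => pin.
  have d1 : det (w p) (w q) (w i) <= 0 by apply: det_between_le0 => //; lia.
  have d2 : det (w p) (w q) (w j) <= 0 by apply: det_between_le0 => //; lia.
  move=> /(congr1 -%R); rewrite opprD -!mulrN oppr0.
  case/mix_eq0; rewrite ?oppr_ge0// => /eqP; rewrite oppr_eq0 => /eqP e1 /eqP.
  by rewrite oppr_eq0 => /eqP; exact: nz.
have d1 : 0 <= det (w p) (w q) (w i) by apply: det_beyond_ge0 => //; lia.
have d2 : 0 <= det (w p) (w q) (w j) by apply: det_beyond_ge0 => //; lia.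
by case/mix_eq0.
Qed.

Section Sides.
Hypothesis n3 : (3 <= n)%N.

Definition cyc_succ i := if (i.+1 < n)%N then i.+1 else 0%N.

Definition in_sides (x : plane) :=
  forall i, (i < n)%N -> 0 <= det (w i) (w (cyc_succ i)) x.

Lemma side_gt0 i j : (i < n)%N -> (j < n)%N -> j != i -> j != cyc_succ i ->
  0 < det (w i) (w (cyc_succ i)) (w j).
Proof.
move=> i_n jn ji; rewrite /cyc_succ; case: ifPn => [i1|i1] ji1.
  by apply: det_beyond => //; lia.
by rewrite det_rot det_rot hw//; lia.
Qed.

Lemma side_ge0 i j : (i < n)%N -> (j < n)%N ->
  0 <= det (w i) (w (cyc_succ i)) (w j).
Proof.
move=> i_n jn.
have [->|ji] := eqVneq j i; first by rewrite detll.
have [->|jn1] := eqVneq j (cyc_succ i); first by rewrite detlr.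
by apply/ltW/side_gt0.
Qed.

(** A supporting line at i that misses j: the side leaving i, or the side entering i when j is the
    next vertex. *)
Lemma exists_support i j : (i < n)%N -> (j < n)%N -> i != j ->
  exists k l, [/\ det (w k) (w l) (w i) = 0, 0 < det (w k) (w l) (w j)
    & forall x, in_sides x -> 0 <= det (w k) (w l) x].
Proof.
move=> i_n jn ij; have [jnx|jnx] := eqVneq j (cyc_succ i); last first.
  exists i, (cyc_succ i); split; first by rewrite detll.
    by apply: side_gt0 => //; rewrite eq_sym.
  by move=> x; apply.
pose k := if i == 0%N then n.-1 else i.-1.
have kn : (k < n)%N by rewrite /k; case: ifP => _; lia.
have ki : cyc_succ k = i.
  rewrite /k /cyc_succ; case: (posnP i) => [->|i0].
    by rewrite prednK ?ltnn//; lia.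
  by rewrite prednK// i_n.
exists k, i; split; first by rewrite detlr.
  rewrite -ki; apply: side_gt0; rewrite ?ki// 1?eq_sym//.
  rewrite jnx /k /cyc_succ; case: (posnP i) => [->|i0].
    by case: ifP; lia.
  by case: ifP; lia.
by move=> x /(_ k kn); rewrite ki.
Qed.

(** Supporting lines at the two ends confine the parameter of x on the line to the unit interval. *)
Lemma chord_segm i j x : (i < n)%N -> (j < n)%N -> i != j -> in_sides x ->
  det (w i) (w j) x = 0 -> segm (w i) (w j) x.
Proof.
move=> i_n jn ij xs d0.
have [k [l [ki kj kx]]] := exists_support i_n jn ij.
have ji : j != i by rewrite eq_sym.
have [k' [l' [ki' kj' kx']]] := exists_support jn i_n ji.
have wij : w i <> w j by move=> e; move: kj; rewrite -e ki ltxx.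
have [t xt] := det_eq0_mix wij d0.
exists t => //=; rewrite in_itv /=.
have := kx x xs; rewrite xt det_mix ki mulr0 add0r pmulr_lge0// => ->.
have := kx' x xs; rewrite xt det_mix ki' mulr0 addr0 pmulr_lge0// subr_ge0.
by [].
Qed.

Lemma vertex_not_on_chord i j k : (i < j)%N -> (j < n)%N -> (k < n)%N ->
  ~ open_segm (w i) (w j) (w k).
Proof.
move=> ij jn kn [t /=]; rewrite in_itv/= => /andP[t0 t1] e.
have i_n : (i < n)%N by lia.
have ijN : i != j by lia.
have jiN : j != i by lia.
have [k1 [l [ki kj _]]] := exists_support i_n jn ijN.
have [k' [l' [ki' kj' _]]] := exists_support jn i_n jiN.
have d0 : det (w i) (w j) (w k) = 0.
  by rewrite -e det_mix detll detlr !mulr0 addr0.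
have [ek|ek] := det_vertex_eq0 ij jn kn d0; move: e; rewrite ek.
  move/(congr1 (det (w k1) (w l))); rewrite det_mix ki mulr0 add0r.
  by move/eqP; rewrite mulf_eq0 !gt_eqF.
move/(congr1 (det (w k') (w l'))); rewrite det_mix ki' mulr0 addr0.
by move/eqP; rewrite mulf_eq0 !gt_eqF// subr_gt0.
Qed.

End Sides.
End Signs.

(** * Topology of the plane *)

Section PlaneTopology.
Variable R : realType.
Local Notation plane := (R * R)%type.
Implicit Types (a b c x y : plane) (A C D K U : set plane).

Lemma continuous_det a b : continuous (det a b : plane -> R).
Proof.
move=> x; apply: cvgB; apply: cvgM; try exact: cvg_cst.
  by apply: cvgB; [exact: cvg_snd|exact: cvg_cst].
by apply: cvgB; [exact: cvg_fst|exact: cvg_cst].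
Qed.

Lemma open_det_gt0 a b : open [set x | 0 < det a b x].
Proof.
apply: (@open_comp _ _ (det a b) [set y | 0 < y]); last exact: open_gt.
by move=> x _; exact: continuous_det.
Qed.

Lemma closed_det_ge0 a b : closed [set x | 0 <= det a b x].
Proof.
apply: (@preimage_closed _ _ (det a b) [set y | 0 <= y]); last exact: closed_ge.
by move=> x _; exact: continuous_det.
Qed.

Lemma closure_det_ge0 A a b : (forall x, A x -> 0 <= det a b x) ->
  forall x, closure A x -> 0 <= det a b x.
Proof.
move=> Aab x Ax; suff : [set y | 0 <= det a b y] x by [].
by rewrite ((closure_id _).1 (@closed_det_ge0 a b)); apply: closureS Ax.
Qed.

Lemma continuous_mix x y : continuous (fun t : R => (1 - t) *: x + t *: y : plane).
Proof.
move=> t; apply: cvgD; last by apply: cvgZl; exact: cvg_id.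
by apply: cvgZl; apply: cvgB; [exact: cvg_cst|exact: cvg_id].
Qed.

Lemma connected_segm x y : connected (segm x y).
Proof.
apply: connected_continuous_connected; first exact: segment_connected.
by apply: continuous_subspaceT => t; exact: continuous_mix.
Qed.

Lemma segm_left x y : segm x y x.
Proof. by exists 0; rewrite ?subr0 ?scale1r ?scale0r ?addr0//= in_itv/= lexx ler01. Qed.

Lemma segm_right x y : segm x y y.
Proof. by exists 1; rewrite ?subrr ?scale1r ?scale0r ?add0r//= in_itv/= lexx ler01. Qed.

Lemma sub_connected_component A D x :
  (forall y z, A y -> A z -> segm y z `<=` A) -> A `<=` D -> A x ->
  A `<=` connected_component D x.
Proof.
move=> cA AD Ax y Ay; apply: (@connected_component_max _ _ (segm x y)).
- exact: segm_left.
- exact: subset_trans (cA _ _ Ax Ay) AD.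
- exact: connected_segm.
- exact: segm_right.
Qed.

(** The part of C in U is nonempty and open in C, and it is closed in C because it equals the part
    in K. *)
Lemma connected_sub_open C U K x : connected C -> C x -> U x -> open U ->
  closed K -> U `<=` K -> C `&` K `<=` U -> C `<=` U.
Proof.
move=> cC Cx Ux oU cK UK CKU.
have <- : C `&` U = C.
  apply: cC; [by exists x|by exists U|exists K => //].
  apply/seteqP; split => y [Cy hy]; first by split => //; exact: UK.
  by split => //; apply: CKU.
by move=> y [].
Qed.

Lemma segm_det_gt0 a b x y : 0 < det a b x -> 0 < det a b y ->
  segm x y `<=` [set z | 0 < det a b z].
Proof.
move=> x0 y0 z [t /= + <-]; rewrite in_itv/= det_mix => /andP[t0 t1].
have [->|tn] := eqVneq t 0; first by rewrite subr0 mul1r mul0r addr0.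
have tp : 0 < t by rewrite lt_neqAle eq_sym tn.
apply: ltr_wpDl; last exact: mulr_gt0.
by apply: mulr_ge0; [rewrite subr_ge0|exact: ltW].
Qed.

Lemma halfplane_unbounded a b x C : a <> b ->
  [set y | det a b y = det a b x] `<=` C -> ~ bounded_set C.
Proof.
move=> ab hC /= /ex_strict_bound_gt0[M M0 /= CM].
have ba0 : 0 < `|b - a| by rewrite normr_gt0 subr_eq0 eq_sym; apply/eqP.
(* This s makes the displacement along the line through x have norm M + |x|, too long to stay within
   M of the origin. *)
pose s := (M + `|x|) / `|b - a|.
have s0 : 0 <= s by rewrite divr_ge0// addr_ge0// ltW.
have /CM /= : C (x + s *: (b - a)).
  apply: hC => /=; rewrite /det.
  have -> : (x + s *: (b - a)).1 = x.1 + s * (b.1 - a.1) by [].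
  have -> : (x + s *: (b - a)).2 = x.2 + s * (b.2 - a.2) by [].
  by ring.
apply/negP; rewrite -leNgt -(lerD2r `|x|).
have -> : M + `|x| = `|s *: (b - a)|.
  by rewrite normrZ ger0_norm// /s divfK// gt_eqF.
have {1}-> : s *: (b - a) = (x + s *: (b - a)) - x by rewrite [RHS]addrC addKr.
exact: ler_normB.
Qed.

Lemma bounded_open_triangle a b c : bounded_set (open_triangle a b c).
Proof.
pose M := Num.max `|a| (Num.max `|b| `|c|).
exists M; split; first exact: num_real.
move=> N MN x [x1 x2 x3] /=.
have cB : @convex_set R plane [set y | `|y| <= M].
  move=> y z l /set_mem /= yM /set_mem /= zM; apply/mem_set => /=.
  apply: le_trans (ler_normD _ _) _; rewrite !normrZ.
  have l0 : 0 <= l%:num by exact: ge0.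
  have l1 : l%:num <= 1 by exact: le1.
  rewrite /unstable.onem !ger0_norm ?subr_ge0//.
  have := ler_wpM2l l0 yM.
  have l1' : 0 <= 1 - l%:num by rewrite subr_ge0.
  have := ler_wpM2l l1' zM.
  lra.
apply: le_trans (ltW MN).
have maxP (X Y Z : R) : [/\ X <= Num.max X (Num.max Y Z),
    Y <= Num.max X (Num.max Y Z) & Z <= Num.max X (Num.max Y Z)].
  by rewrite !le_max !lexx !orbT.
have [aM bM cM] := maxP `|a| `|b| `|c|.
exact: (convex_triangle cB aM bM cM x1 x2 x3).
Qed.

Lemma open_triangle_centroid a b c : 0 < det a b c ->
  open_triangle a b c (3^-1 *: (a + b + c)).
Proof.
move=> d.
have e1 : (3^-1 *: (a + b + c)).1 = 3^-1 * (a.1 + b.1 + c.1) by [].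
have e2 : (3^-1 *: (a + b + c)).2 = 3^-1 * (a.2 + b.2 + c.2) by [].
have E : 0 < 3^-1 * det a b c by rewrite mulr_gt0.
by split; rewrite (_ : det _ _ (_ *: _) = 3^-1 * det a b c)// /det e1 e2; field.
Qed.

Lemma open_triangle_rot a b c : open_triangle b c a = open_triangle a b c.
Proof. by apply/seteqP; split => x [? ? ?]; split. Qed.

Lemma segm_sub_closure_triangle a b c : 0 < det a b c ->
  segm a b `<=` closure (open_triangle a b c).
Proof.
move=> d x [t /= + xt]; rewrite in_itv/= => /andP[t0 t1] B Bx.
have [g1 g2 g3] := open_triangle_centroid d.
set g := (3^-1 *: (a + b + c)) in g1 g2 g3 *.
have x1 : det a b x = 0 by rewrite -xt det_mix detll detlr !mulr0 addr0.
have x2 : 0 <= det b c x.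
  rewrite -xt det_mix detll mulr0 addr0 det_rot.
  by apply: mulr_ge0; [rewrite subr_ge0|exact: ltW].
have x3 : 0 <= det c a x.
  rewrite -xt det_mix detlr mulr0 add0r det_rot det_rot; apply: mulr_ge0 => //; exact: ltW.
(* Moving x slightly towards the centroid g stays in the neighbourhood B and makes all three
   determinants positive. *)
have : \forall e \near (0 : R)^'+, B ((1 - e) *: x + e *: g).
  have := @continuous_mix x g 0; rewrite /continuous_at.
  rewrite subr0 scale1r scale0r addr0 => /(_ _ Bx) /= Be.
  exact: cvg_at_right_filter Be.
move=> near0.
have near1 : \forall e \near (0 : R)^'+, 0 < e < 1.
  near=> e; apply/andP; split; first by [].
  by near: e; exact: nbhs_right_lt.
have [e [Be /andP[e0 e1]]] := filter_ex (filterI near0 near1).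
have u0 : 0 < 1 - e by rewrite subr_gt0.
exists ((1 - e) *: x + e *: g); split => //; split; rewrite det_mix.
- by rewrite x1 mulr0 add0r mulr_gt0.
- by apply: ltr_wpDl; [exact: mulr_ge0 (ltW u0) _|exact: mulr_gt0].
- by apply: ltr_wpDl; [exact: mulr_ge0 (ltW u0) _|exact: mulr_gt0].
Unshelve. all: by end_near. Qed.

End PlaneTopology.

(** * Faces of a plane graph containing the edges of a tree *)

Definition relabel (R : realType) n (v : 'I_n -> R * R) (s : nat -> 'I_n) k :=
  v (s k).

Section Drawing.
Variables (R : realType) (n : nat) (v : 'I_n -> R * R).
Variables (s : nat -> 'I_n) (r : 'I_n -> nat).
Local Notation plane := (R * R)%type.
Local Notation w := (relabel v s).
Hypothesis n3 : (3 <= n)%N.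
Hypothesis rK : forall i, s (r i) = i.
Hypothesis r_lt : forall i, (r i < n)%N.
Hypothesis sK : forall k, (k < n)%N -> r (s k) = k.
Hypothesis hw : ccw n w.
Implicit Types e : rel 'I_n.

(** Crossing-freeness in terms of the cyclic order only; the other interleaving is obtained by
    exchanging the two edges. *)
Definition noncrossing e := forall a b c d,
  (a < c)%N -> (c < b)%N -> (b < d)%N -> (d < n)%N ->
  e (s a) (s b) -> e (s c) (s d) -> False.

Lemma vE i : v i = w (r i).
Proof. by rewrite /relabel rK. Qed.

Lemma segmC (x y : plane) : segm x y = segm y x.
Proof.
by apply/seteqP; split => z [t /=]; rewrite in_itv/= => /andP[t0 t1] <-;
  (exists (1 - t); [rewrite /= in_itv/= subr_ge0 gerBl t0 t1|rewrite subKr addrC]).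
Qed.

Lemma open_segmC (x y : plane) : open_segm x y = open_segm y x.
Proof.
by apply/seteqP; split => z [t /=]; rewrite in_itv/= => /andP[t0 t1] <-;
  (exists (1 - t); [rewrite /= in_itv/= subr_gt0 gtrBl t0 t1|rewrite subKr addrC]).
Qed.

Lemma crossing_free_noncrossing e : crossing_free v e -> noncrossing e.
Proof.
move=> [_ cf] a b c d ac cb bd dn eab ecd.
have [x [xab xcd]] := chords_cross hw ac cb bd dn.
have : (open_segm (w a) (w b) `&` open_segm (w c) (w d)) x by [].
rewrite (cf _ _ _ _ eab ecd)// => /seteqP[+ _] => /(_ (s a)) /= /(_ (or_introl erefl)).
by case=> /(congr1 r); rewrite !sK; lia.
Qed.

Lemma noncrossing_crossing_free e : symmetric e -> irreflexive e ->
  noncrossing e -> crossing_free v e.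
Proof.
move=> es ei nc.
have chord i j : e i j -> exists a b, [/\ (a < b)%N, (b < n)%N, e (s a) (s b),
    open_segm (v i) (v j) = open_segm (w a) (w b) & [set i; j] = [set s a; s b]].
  move=> eij; case: (ltngtP (r i) (r j)) => [ij|ji|ij].
  - by exists (r i), (r j); split; rewrite -?vE ?rK.
  - by exists (r j), (r i); split; rewrite -?vE ?rK ?[e j i]es// 1?open_segmC 1?setUC.
  - by move: eij; rewrite -[i]rK ij rK ei.
split=> [i j k /chord[a [b [ab bn _ -> _]]]|i j k l /chord[a [b [ab bn eab -> ->]]]].
  by rewrite vE; exact: (vertex_not_on_chord hw n3 ab bn (r_lt k)).
move=> /chord[c [d [cd dn ecd -> ->]]] abcd; apply: (chords_disjoint hw) => //.
- by case=> ac bd; apply: abcd; rewrite ac bd.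
- by move=> [ac [cb bd]]; apply: (nc a b c d).
- by move=> [ca [ad db]]; apply: (nc c d a b).
Qed.

Section Faces.
Variable e : rel 'I_n.
Hypothesis e_sym : symmetric e.
Hypothesis e_irr : irreflexive e.
Hypothesis e_nc : noncrossing e.

Lemma drawingP x : drawing v e x ->
  exists a b, [/\ (a <= b)%N, (b < n)%N, a = b \/ e (s a) (s b) & segm (w a) (w b) x].
Proof.
case=> [[i _ <-]|[i [j [eij ijx]]]].
  by exists (r i), (r i); split => //; [left|rewrite -vE; exact: segm_left].
case: (ltngtP (r i) (r j)) => [ij|ji|ij].
- by exists (r i), (r j); split; rewrite -?vE ?rK//; [exact: ltnW|right].
- exists (r j), (r i); split; rewrite -?vE ?rK//; first exact: ltnW.
    by right; rewrite e_sym.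
  by rewrite segmC.
- by move: eij; rewrite -[i]rK ij rK e_irr.
Qed.

Lemma drawing_edge a b x : e (s a) (s b) -> segm (w a) (w b) x -> drawing v e x.
Proof. by move=> eab abx; right; exists (s a), (s b). Qed.

(** Every edge or vertex of the drawing stays on one arc cut off by the triangle, hence weakly
    beyond one side, while the face lies strictly within it. *)
Lemma face_misses_drawing i j k x : (i < j)%N -> (j < k)%N -> (k < n)%N ->
  e (s i) (s j) -> e (s j) (s k) -> e (s i) (s k) ->
  face w (i, j, k) x -> ~ drawing v e x.
Proof.
move=> ij jk kn eij ejk eik [/= x1 x2 x3] /drawingP[p [q [pq qn epq [t /= + pqx]]]].
rewrite in_itv/= => /andP[t0 t1].
have nc a b : (a < b)%N -> (b < n)%N -> e (s a) (s b) ->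
    ~ (a < p /\ p < b /\ b < q)%N /\ ~ (p < a /\ a < q /\ q < b)%N.
  move=> ab bn eab; case: epq => [pqE|epq]; first lia.
  split=> [[ap [pb bq]]|[pa [aq qb]]]; first exact: (e_nc ap pb bq qn eab epq).
  exact: (e_nc pa aq qb bn epq eab).
have mixN y z : det y z (w p) <= 0 -> det y z (w q) <= 0 -> 0 < det y z x -> False.
  move=> yp yq; rewrite -pqx det_mix ltNge => /negP; apply.
  by rewrite -[leRHS]addr0; apply: lerD; apply: mulr_ge0_le0 => //; rewrite subr_ge0.
have [nij1 nij2] := nc i j ij (ltn_trans jk kn) eij.
have [njk1 njk2] := nc j k jk kn ejk.
have [nik1 nik2] := nc i k (ltn_trans ij jk) kn eik.
have jn := ltn_trans jk kn; have pn := leq_ltn_trans pq qn.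
have [/andP[ip qj]|/andP[jp qk]|/andP[pik qik]] := or3P
  (noncrossing_arc ij jk pq nij1 nij2 njk1 njk2 nik1 nik2).
- have pj := leq_trans pq qj; have iq := leq_trans ip pq.
  exact: mixN (det_between_le0 hw ip pj jn) (det_between_le0 hw iq qj jn) x1.
- have pk := leq_trans pq qk; have jq := leq_trans jp pq.
  exact: mixN (det_between_le0 hw jp pk kn) (det_between_le0 hw jq qk kn) x2.
- have ik := ltn_trans ij jk.
  by apply: mixN x3; rewrite detC oppr_le0; apply: (det_beyond_ge0 hw).
Qed.

(** A nonpositive determinant says that x lies beneath the chord. Either x is beneath a lower side,
    and the descent continues, or it is in the root triangle; at a leaf x would lie on a side of the
    polygon. *)
Lemma exists_face_in a t x : (a + leaves t < n)%N ->
  (forall p q, (p, q) \in edges a t -> e (s p) (s q)) ->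
  in_sides n w x -> ~ drawing v e x ->
  det (w a) (w (a + leaves t)%N) x <= 0 ->
  exists2 u, u \in tris a t & face w u x.
Proof.
move=> + + xs xD; elim: t a => [|l IHl r' IHr] a.
  rewrite /= addn1 => an ee d0; exfalso; apply: xD.
  have ae : e (s a) (s a.+1) by have := edges_top a Leaf; rewrite /= addn1 => /ee.
  apply: (drawing_edge ae); apply: (chord_segm hw) => //; try lia.
  apply/eqP; rewrite eq_le d0 /=; have nx : cyc_succ n a = a.+1 by rewrite /cyc_succ an.
  by have := xs a; rewrite nx; apply; lia.
move=> an ee d0.
have gl := leaves_gt0 l; have gr := leaves_gt0 r'.
have an' : (a + leaves l + leaves r' < n)%N by move: an => /=; lia.
have [dl|dl] := leP (det (w a) (w (a + leaves l)%N) x) 0.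
  have [||//|u uT ux] := IHl a; first by lia.
    by move=> p q pq; apply: ee; rewrite inE mem_cat pq orbT.
  by exists u => //; rewrite inE mem_cat uT orbT.
have [dr|dr] := leP (det (w (a + leaves l)%N) (w (a + leaves l + leaves r')%N) x) 0.
  have [||//|u uT ux] := IHr (a + leaves l)%N; first by lia.
    by move=> p q pq; apply: ee; rewrite inE mem_cat pq !orbT.
  by exists u => //; rewrite inE mem_cat uT !orbT.
exists (a, a + leaves l, a + leaves (Node l r'))%N; first by rewrite inE eqxx.
split => //=; rewrite addnA//.
move: d0 => /=; rewrite addnA le_eqVlt => /orP[/eqP d0|d0]; last first.
  by rewrite detC oppr_gt0.
exfalso; apply: xD.
apply: (@drawing_edge a (a + leaves l + leaves r')%N).
  by apply: ee; rewrite -addnA; exact: (edges_top a (Node l r')).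
by apply: (chord_segm hw) => //; lia.
Qed.

Variable t : btree.
Hypothesis t_leaves : leaves t = n.-1.
Hypothesis t_edges : forall p q, (p, q) \in edges 0 t -> e (s p) (s q).

Lemma tri_bound i j k : (i, j, k) \in tris 0 t ->
  [/\ (i < j)%N, (j < k)%N & (k < n)%N].
Proof. by move/tris_bound; rewrite t_leaves => ?; split; lia. Qed.

Lemma tree_edge_bound p q : (p, q) \in edges 0 t -> (p < q)%N /\ (q < n)%N.
Proof. by move/edges_bound; rewrite t_leaves => ?; split; lia. Qed.

Lemma face_nonempty u : u \in tris 0 t -> exists x, face w u x.
Proof.
case: u => [[i j] k] /tri_bound[ij jk kn].
exists (3^-1 *: (w i + w j + w k)); apply: open_triangle_centroid.
exact: hw.
Qed.

Lemma face_disjoint_drawing u : u \in tris 0 t -> face w u `<=` ~` drawing v e.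
Proof.
case: u => [[i j] k] uT; have [ij jk kn] := tri_bound uT.
have [eij ejk eik] := tris_edges uT.
by move=> x; apply: face_misses_drawing => //; exact: t_edges.
Qed.

Lemma component_face u x : u \in tris 0 t -> face w u x ->
  connected_component (~` drawing v e) x = face w u.
Proof.
case: u => [[i j] k] uT ux; have [ij jk kn] := tri_bound uT.
have [eij ejk eik] := tris_edges uT.
apply/seteqP; split; last first.
  apply: sub_connected_component => //; last exact: face_disjoint_drawing.
  move=> y z [y1 y2 y3] [z1 z2 z3] p yzp.
  by split; [exact: segm_det_gt0 yzp|exact: segm_det_gt0 yzp|exact: segm_det_gt0 yzp].
(* The closed triangle: its boundary is drawn, so off the drawing it reduces to the open face. *)
pose K := [set y | 0 <= det (w i) (w j) y] `&` [set y | 0 <= det (w j) (w k) y]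
  `&` [set y | 0 <= det (w k) (w i) y].
apply: (@connected_sub_open _ _ _ K x).
- exact: component_connected.
- by apply: connected_component_refl; exact: face_disjoint_drawing ux.
- exact: ux.
- rewrite (_ : face _ _ = [set y | 0 < det (w i) (w j) y] `&`
    [set y | 0 < det (w j) (w k) y] `&` [set y | 0 < det (w k) (w i) y]).
    by apply: openI; [apply: openI|]; exact: open_det_gt0.
  by apply/seteqP; split => y; [move=> []|move=> [[]]].
- by apply: closedI; [apply: closedI|]; exact: closed_det_ge0.
- by move=> y [y1 y2 y3]; split; [split|]; exact: ltW.
move=> y [/connected_component_sub yD [[/= y1 y2] y3]].
have aff (a b c : plane) : 0 < det a b c -> a <> b -> det a b y = 0 ->
    0 <= det b c y -> 0 <= det c a y -> segm a b y.
  move=> abc ab d0 d1 d2; have [z yz] := det_eq0_mix ab d0.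
  exists z => //=; rewrite in_itv/=.
  move: d1 d2; rewrite yz !det_mix detll detlr !mulr0 addr0 add0r.
  rewrite (det_rot a b c) -(det_rot c a b).
  by rewrite !pmulr_lge0// subr_ge0 => -> ->.
have d : 0 < det (w i) (w j) (w k) by exact: hw.
have neq (a b c : plane) : 0 < det a b c -> a <> b.
  by move=> + ab; rewrite ab /det subrr mul0r subrr mul0r subr0 ltxx.
split; rewrite lt_neqAle ?y1 ?y2 ?y3 andbT eq_sym; apply/eqP => d0; apply: yD.
- by apply: (drawing_edge (t_edges eij)); exact: (aff _ _ _ d (neq _ _ _ d) d0 y2 y3).
- have d' : 0 < det (w j) (w k) (w i) by rewrite det_rot.
  by apply: (drawing_edge (t_edges ejk)); exact: (aff _ _ _ d' (neq _ _ _ d') d0 y3 y1).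
- have d' : 0 < det (w k) (w i) (w j) by rewrite det_rot det_rot.
  apply: (drawing_edge (t_edges eik)); rewrite segmC.
  exact: (aff _ _ _ d' (neq _ _ _ d') d0 y1 y2).
Qed.

Lemma bounded_facesP F : bounded_faces v e F <->
  exists2 u, u \in tris 0 t & F = face w u.
Proof.
split=> [[Fb [x xD FE]]|[u uT ->]]; last first.
  have [x ux] := face_nonempty uT.
  split; first exact: bounded_open_triangle.
  exists x; first exact: face_disjoint_drawing ux.
  by rewrite (component_face uT ux).
have [xs|/existsNP[i /not_implyP[i_n /negP]]] := pselect (in_sides n w x).
  have [|//|u uT ux] := @exists_face_in 0%N t x _ t_edges xs xD.
  - by rewrite t_leaves; lia.
  (* The root chord is the closing side of the polygon read backwards, so every point of the polygon
     lies beneath it. *)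
  - have := xs n.-1; rewrite /cyc_succ prednK ?ltnn; last by lia.
    by rewrite add0n t_leaves detC oppr_ge0; apply; lia.
  by exists u => //; rewrite FE; exact: component_face.
rewrite -ltNge => xi; exfalso; move: Fb; rewrite FE.
apply: (@halfplane_unbounded _ (w i) (w (cyc_succ n i)) x).
  by move=> wi; move: xi; rewrite -wi /det subrr mul0r subrr mul0r subr0 ltxx.
(* The open half-plane beyond side i contains nothing of the drawing, so it lies in the component of
   x, which is therefore unbounded. *)
pose H := [set y | 0 < det (w (cyc_succ n i)) (w i) y].
have Hx : H x by rewrite /H /= detC oppr_gt0.
apply: (@subset_trans _ H).
  by move=> y /= yx; rewrite /H /= detC oppr_gt0 yx.
apply: sub_connected_component => //; first by move=> y z; exact: segm_det_gt0.
move=> y + /drawingP[a [b [ab bn _ [z /= + aby]]]].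
rewrite in_itv/= /H /= => + /andP[z0 z1]; rewrite detC -aby oppr_gt0 det_mix.
rewrite ltNge => /negP; apply; apply: addr_ge0; apply: mulr_ge0.
- by rewrite subr_ge0.
- by apply: (side_ge0 hw) => //; lia.
- by [].
- exact: (side_ge0 hw).
Qed.

Lemma face_side u p q : u \in tris 0 t -> (p, q) \in edges 0 t ->
  (forall x, face w u x -> det (w p) (w q) x < 0) \/
  (forall x, face w u x -> 0 < det (w p) (w q) x).
Proof.
case: u => [[i j] k] uT pqT; have [ij jk kn] := tri_bound uT.
have [pq qn] := tree_edge_bound pqT.
have [eij ejk eik] := tris_edges uT.
have [iu|/negP iu] := boolP (inside (p, q) (i, j, k)).
  by left => x; exact: (face_inside hw ij jk qn iu).
right => x; apply: (face_outside hw) => //.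
have := edges_noncrossing eij pqT; have := edges_noncrossing pqT eij.
have := edges_noncrossing ejk pqT; have := edges_noncrossing pqT ejk.
have := edges_noncrossing eik pqT; have := edges_noncrossing pqT eik.
by move: iu; rewrite /inside /outside /=; lia.
Qed.

Lemma parent_dual_adj u u' : u \in tris 0 t -> u' \in tris 0 t -> parent u u' ->
  dual_adj v e (face w u) (face w u').
Proof.
case: u u' => [[i j] k] [[i' j'] k'] uT uT'.
have [ij jk kn] := tri_bound uT; have [ij' jk' kn'] := tri_bound uT'.
have [eij ejk eik] := tris_edges uT; have [eij' ejk' eik'] := tris_edges uT'.
have main p q : (p, q) \in edges 0 t -> i' = p -> k' = q ->
    outside (p, q) (i, j, k) -> segm (w p) (w q) `<=` closure (face w (i, j, k)) ->
    dual_adj v e (face w (i, j, k)) (face w (i', j', k')).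
  move=> pqT pE qE out cl; have [pq qn] := tree_edge_bound pqT.
  split; try by apply/bounded_facesP; eexists; [|reflexivity].
    move=> uu'; have [x xu] := face_nonempty uT.
    have := face_outside hw ij jk kn pq qn out xu.
    rewrite uu' in xu; apply/negP; rewrite -leNgt; apply: ltW.
    by apply: (face_inside hw ij' jk' qn _ xu); rewrite /inside /= pE qE !leqnn.
  exists (s p), (s q); split; first exact: t_edges.
  rewrite subsetI; split => //; rewrite -/(w p) -/(w q) -pE -qE segmC.
  rewrite /face /= (open_triangle_rot (w k')).
  apply: segm_sub_closure_triangle; rewrite det_rot det_rot; exact: hw.
have d : 0 < det (w i) (w j) (w k) by exact: hw.
case=> /= [[iE kE]|[iE kE]].
- apply: (main i j) => //; first by rewrite /outside /=; lia.
  exact: segm_sub_closure_triangle.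
- apply: (main j k) => //; first by rewrite /outside /=; lia.
  by rewrite /face /= -open_triangle_rot; apply: segm_sub_closure_triangle; rewrite det_rot.
Qed.

(** The edge shared by F and G lies in both closures, hence on the line of every separating chord,
    so it has the same ends as that chord. The sign on F excludes the reversed orientation. *)
Lemma separating_edge_unique F G p q p' q' x :
  dual_adj v e F G -> F x ->
  (p < n)%N -> (q < n)%N -> p != q -> (p' < n)%N -> (q' < n)%N -> p' != q' ->
  (forall y, F y -> det (w p) (w q) y < 0) ->
  (forall y, F y -> det (w p') (w q') y < 0) ->
  (forall y, G y -> 0 < det (w p) (w q) y) ->
  (forall y, G y -> 0 < det (w p') (w q') y) -> (p, q) = (p', q').
Proof.
move=> [_ _ _ [i [j [eij clij]]]] Fx pn qn pq pn' qn' pq' F1 F2 G1 G2.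
have ij : r i != r j.
  by apply/eqP => rij; move: eij; rewrite -[i]rK rij rK e_irr.
have on_line a b : (a < n)%N -> (b < n)%N -> a != b ->
    (forall y, F y -> det (w a) (w b) y < 0) ->
    (forall y, G y -> 0 < det (w a) (w b) y) ->
    (r i = a /\ r j = b) \/ (r i = b /\ r j = a).
  move=> an bn ab Fab Gab.
  have zero y : segm (v i) (v j) y -> det (w a) (w b) y = 0.
    move=> /clij[yF yG]; apply/eqP; rewrite eq_le; apply/andP; split.
      rewrite -oppr_ge0 -detC; apply: closure_det_ge0 yF => z /Fab zab.
      by rewrite detC oppr_ge0 ltW.
    by apply: closure_det_ge0 yG => z /Gab /ltW.
  have vertex k : (k < n)%N -> det (w a) (w b) (w k) = 0 -> k = a \/ k = b.
    move=> kn d0; case: (ltngtP a b) => [ltab|ltba|eqab].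
    - exact: (det_vertex_eq0 hw ltab bn kn d0).
    - have d0' : det (w b) (w a) (w k) = 0 by rewrite detC d0 oppr0.
      by case: (det_vertex_eq0 hw ltba an kn d0'); [right|left].
    - by rewrite eqab eqxx in ab.
  have := vertex (r i) (r_lt i) _; rewrite -vE.
  have := vertex (r j) (r_lt j) _; rewrite -vE.
  move=> /(_ (zero _ (segm_right _ _))) hj /(_ (zero _ (segm_left _ _))) hi.
  by move: ij hi hj => /eqP; lia.
have h1 := on_line p q pn qn pq F1 G1.
have h2 := on_line p' q' pn' qn' pq' F2 G2.
have [[-> ->]//|[pE qE]] : (p = p' /\ q = q') \/ (p = q' /\ q = p') by lia.
by have := F2 x Fx; rewrite -pE -qE detC oppr_lt0 ltNge ltW// F1.
Qed.

(* Crossing from a face to an adjacent one changes sides of at most one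
   chord, so a walk is at least as long as the number of chords that separate
   its ends. *)
Lemma walk_crosses k u u' (S : seq (nat * nat)) :
  uniq S -> u \in tris 0 t -> u' \in tris 0 t ->
  (forall p q, (p, q) \in S -> (p, q) \in edges 0 t \/ (q, p) \in edges 0 t) ->
  (forall p q x, (p, q) \in S -> face w u x -> det (w p) (w q) x < 0) ->
  (forall p q x, (p, q) \in S -> face w u' x -> 0 < det (w p) (w q) x) ->
  walk (dual_adj v e) k (face w u) (face w u') -> (size S <= k)%N.
Proof.
elim: k u S => [|k IH] u S uS uT uT' SE Su Su' /=.
  move=> uu'; case: S uS SE Su Su' => [//|[p q] S] _ _ Su Su'.
  have [x ux] := face_nonempty uT.
  have := Su p q x (mem_head _ _) ux; rewrite uu' in ux.
  by rewrite ltNge ltW// (Su' p q x (mem_head _ _)).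
move=> [z [uz zu']].
have [z' zT zE] : exists2 z', z' \in tris 0 t & z = face w z'.
  by apply/bounded_facesP; case: uz.
(* Chords with [neg] still separate z from the end of the walk; the others were crossed by the first
   step. *)
pose neg (c : nat * nat) := `[< forall x, z x -> det (w c.1) (w c.2) x < 0 >].
have side p q : (p, q) \in S -> ~~ neg (p, q) ->
    forall x, z x -> 0 < det (w p) (w q) x.
  move=> /SE pqT /asboolPn npq x; rewrite zE => zx.
  case: pqT => pqT; case: (face_side zT pqT) => h.
  - by exfalso; apply: npq => y; rewrite zE => /h.
  - exact: h.
  - by rewrite detC oppr_gt0 h.
  - by exfalso; apply: npq => y /=; rewrite zE => /h; rewrite detC oppr_gt0.
have ends p q : (p, q) \in S -> [/\ (p < n)%N, (q < n)%N & p != q].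
  by case/SE => /tree_edge_bound[pq qn]; split; lia.
have S1 : (size [seq c <- S | ~~ neg c] <= 1)%N.
  have [x ux] := face_nonempty uT.
  have uS' : uniq [seq c <- S | ~~ neg c] by rewrite filter_uniq.
  have eqS c c' : c \in [seq c <- S | ~~ neg c] ->
      c' \in [seq c <- S | ~~ neg c] -> c = c'.
    case: c c' => [p q] [p' q']; rewrite !mem_filter.
    move=> /andP[npq pqS] /andP[npq' pqS'].
    have [pn qn pq] := ends _ _ pqS; have [pn' qn' pq'] := ends _ _ pqS'.
    apply: (separating_edge_unique uz ux) => //.
    - by move=> y; exact: Su pqS.
    - by move=> y; exact: Su pqS'.
    - exact: side.
    - exact: side.
  move: uS' eqS; case: [seq c <- S | ~~ neg c] => [//|c [//|c' S']] /=.
  rewrite inE negb_or => /andP[/andP[/eqP cc' _] _] /(_ c c').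
  by rewrite !inE !eqxx orbT => /(_ isT isT).
have S2 : (size [seq c <- S | neg c] <= k)%N.
  apply: (IH z') => //.
  - exact: filter_uniq.
  - by move=> p q; rewrite mem_filter => /andP[_ /SE].
  - move=> p q x; rewrite mem_filter => /andP[/asboolP h _].
    by rewrite -zE => /h.
  - by move=> p q x; rewrite mem_filter => /andP[_]; exact: Su'.
  - by rewrite -zE.
by rewrite -(count_predC neg S) -!size_filter -addn1; exact: leq_add S2 S1.
Qed.

Lemma exists_far_faces : exists u u', [/\ u \in tris 0 t, u' \in tris 0 t &
  forall k, walk (dual_adj v e) k (face w u) (face w u') -> (diam t <= k)%N].
Proof.
have tL : t <> Leaf by move=> tL; move: t_leaves; rewrite tL /=; lia.
have [u [u' [S1 [S2 [[uT uT' uS1 uS2 <-] [S1E S2E S1u S2u]]]]]] :=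
  exists_separated_triangles 0 tL.
exists u, u'; split => // k wk.
(* Reversing the chords of [S2] puts [u] on the negative side of every chord, and keeps the two
   lists disjoint since tree edges are increasing pairs. *)
pose swap (c : nat * nat) := (c.2, c.1).
have swapK : involutive swap by case.
have mem_swap p q : ((p, q) \in map swap S2) = ((q, p) \in S2).
  by rewrite -[(p, q)]/(swap (q, p)) mem_map//; exact: inv_inj.
rewrite -(size_map swap S2) -size_cat.
case: u u' uT uT' wk S1u S2u => [[i j] l] [[i' j'] l'] uT uT' wk S1u S2u.
have [ij jl ln] := tri_bound uT; have [ij' jl' ln'] := tri_bound uT'.
apply: (walk_crosses _ uT uT') wk.
- rewrite cat_uniq uS1 (map_inj_uniq (inv_inj swapK)) uS2 andbT /=.
  apply/hasPn => -[p q]; rewrite mem_swap => /S2E/tree_edge_bound pq.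
  by apply/negP => /S1E/tree_edge_bound; lia.
- by move=> p q; rewrite mem_cat mem_swap => /orP[/S1E|/S2E]; [left|right].
- move=> p q x; rewrite mem_cat mem_swap => /orP[] pqS.
    have [pq qn] := tree_edge_bound (S1E _ pqS).
    by have /andP[h _] := S1u _ pqS; exact: (face_inside hw ij jl qn h).
  have [pq qn] := tree_edge_bound (S2E _ pqS); have /andP[h _] := S2u _ pqS.
  by rewrite detC oppr_lt0; exact: (face_outside hw).
- move=> p q x; rewrite mem_cat mem_swap => /orP[] pqS.
    have [pq qn] := tree_edge_bound (S1E _ pqS).
    by have /andP[_ h] := S1u _ pqS; exact: (face_outside hw).
  have [pq qn] := tree_edge_bound (S2E _ pqS); have /andP[_ h] := S2u _ pqS.
  by rewrite detC oppr_gt0; exact: (face_inside hw ij' jl' qn h).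
Qed.

Lemma dual_adjC F G : dual_adj v e F G -> dual_adj v e G F.
Proof.
move=> [bF bG FG [i [j [eij h]]]]; split => //; first by move=> GF; exact: FG.
by exists i, j; rewrite setIC.
Qed.

Lemma dual_diameterE : dual_diameter v e = (diam t)%:R%:E.
Proof.
apply/eqP; rewrite eq_le; apply/andP; split.
  apply: ge_ereal_sup => _ [[F G] [/= /bounded_facesP[u uT ->]
    /bounded_facesP[u' uT' ->]] <-].
  have [k kd wk] := walk_diam dual_adjC (f := face w)
    (fun u u' => @parent_dual_adj u u') uT uT'.
  apply: (@le_trans _ _ (k%:R%:E : \bar R)); last by rewrite lee_fin ler_nat.
  by apply: ereal_inf_lbound; exists k.
have [u [u' [uT uT' uk]]] := exists_far_faces.
apply: (@le_trans _ _ (graph_dist R (dual_adj v e) (face w u) (face w u'))).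
  by apply: le_ereal_inf_tmp => _ [k /= /uk dk <-]; rewrite lee_fin ler_nat.
apply: ereal_sup_ubound; exists (face w u, face w u') => //=.
by split; apply/bounded_facesP; eexists; [|reflexivity| |reflexivity].
Qed.

End Faces.

(** * Triangulations and binary trees *)

Implicit Types P : set plane.

Lemma s_eq a b : (a < n)%N -> (b < n)%N -> (s a == s b) = (a == b).
Proof.
by move=> an bn; apply/eqP/eqP => [/(congr1 r)|->//]; rewrite !sK.
Qed.

Lemma noncrossing_plane_graph P e : P = conv_hull (range v) ->
  symmetric e -> irreflexive e -> noncrossing e -> plane_graph_in v P e.
Proof.
move=> PE es ei nc; split=> //.
  exact: (noncrossing_crossing_free es ei nc).
move=> i j _ x [t /= t01 <-]; rewrite PE => B [cB vB].
by apply: convex_mix => //; apply: vB; [exists i|exists j].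
Qed.

Lemma plane_graph_noncrossing P e : plane_graph_in v P e -> noncrossing e.
Proof. by case=> _ cf _; exact: (crossing_free_noncrossing cf). Qed.

(** Adding the chord to [e] gives another plane graph in P, so by maximality it was already
    present. *)
Lemma triangulation_edge P e p q : P = conv_hull (range v) ->
  triangulation v P e -> (p < q)%N -> (q < n)%N ->
  (forall a b, (a < b)%N -> (b < n)%N -> e (s a) (s b) ->
    ~ (p < a /\ a < q /\ q < b)%N /\ ~ (a < p /\ p < b /\ b < q)%N) ->
  e (s p) (s q).
Proof.
move=> PE [plane_e emax] pq qn nc; have [[es ei] _ _] := plane_e.
have enc := plane_graph_noncrossing plane_e.
pose e' : rel 'I_n := fun i j =>
  [|| e i j, (i == s p) && (j == s q) | (i == s q) && (j == s p)].
apply: (emax e'); first apply: noncrossing_plane_graph => //.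
- move=> i j; rewrite /e' es; congr orb.
  by rewrite orbC; congr orb; rewrite andbC.
- move=> i; rewrite /e' ei /=; apply/negbTE/negP.
  by case/orP => /andP[/eqP ->]; rewrite s_eq => [/eqP||]; lia.
- move=> a b c d ac cb bd dn; rewrite /e' !s_eq; try lia.
  move=> /or3P[eab|ab|ab] /or3P[ecd|cd|cd]; try lia.
  + exact: enc ac cb bd dn eab ecd.
  + by have := nc a b _ _ eab; lia.
  + by have := nc c d _ _ ecd; lia.
- by move=> i j eij; rewrite /e' eij.
- by rewrite /e' !eqxx orbT.
Qed.

Lemma triangulation_tree P e : P = conv_hull (range v) -> triangulation v P e ->
  exists t, leaves t = n.-1 /\
    forall p q, (p, q) \in edges 0 t -> e (s p) (s q).
Proof.
move=> PE te; have enc := plane_graph_noncrossing te.1.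
have [||||t [tn tE]] := @exists_subtree (fun a b => e (s a) (s b)) n _ _ 0 n.-1.
- by move=> i i_n; apply: (triangulation_edge PE te) => //; lia.
- move=> i j /andP[ij jn] eij.
  (* The apex is the largest neighbour k of i before j. An edge crossing (k, j) would cross (i, j)
     or (i, k), or would start at i and contradict the choice of k. *)
  pose Q k := (i < k < j)%N && e (s i) (s k).
  have exQ : exists k, Q k.
    exists i.+1; rewrite /Q ltnSn ij /=; apply: (triangulation_edge PE te); lia.
  have ubQ k : Q k -> (k <= j)%N by case/andP => /andP[_ /ltnW].
  case: (ex_maxnP exQ ubQ) => k /andP[ikj eik] kmax.
  exists k => //; split => //; apply: (triangulation_edge PE te) => //; first lia.
  move=> a b ab bn eab; split => [[ka [aj jb]]|[ak [kb bj]]].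
    by apply: (enc i j a b) => //; lia.
  have [ai|ia|ai] := ltngtP a i.
  - by apply: (enc a b i j) => //; lia.
  - by apply: (enc i k a b) => //; lia.
  - have : Q b by rewrite /Q -{2}ai eab andbT; lia.
    by move/kmax; lia.
- lia.
- by apply: (triangulation_edge PE te) => //; lia.
- by exists t.
Qed.

Definition tree_rel t : rel 'I_n := fun i j =>
  ((r i, r j) \in edges 0 t) || ((r j, r i) \in edges 0 t).

Lemma tree_rel_s t a b : (a < b)%N -> (b < n)%N ->
  tree_rel t (s a) (s b) = ((a, b) \in edges 0 t).
Proof.
move=> ab bn; rewrite /tree_rel !sK//; last by lia.
by case: ((b, a) \in _) / idP => [/edges_bound|]; [lia|rewrite orbF].
Qed.

Lemma tree_triangulation P t : P = conv_hull (range v) -> leaves t = n.-1 ->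
  triangulation v P (tree_rel t).
Proof.
move=> PE tn; split.
  apply: noncrossing_plane_graph => //.
  - by move=> i j; rewrite /tree_rel orbC.
  - move=> i; rewrite /tree_rel orbb; apply/negP => /edges_bound; lia.
  - move=> a b c d ac cb bd dn; rewrite !tree_rel_s; try lia.
    by move=> /edges_noncrossing h /h; apply.
move=> e' plane_e' sub i j eij; have [[es ei] _ _] := plane_e'.
have nc' := plane_graph_noncrossing plane_e'.
have main p q : (p < q)%N -> (q < n)%N -> e' (s p) (s q) -> (p, q) \in edges 0 t.
  move=> pq qn epq; apply: edges_maximal => //; first by rewrite tn; lia.
  move=> p' q' pqT; have bd := edges_bound pqT; rewrite tn in bd.
  have pq' : e' (s p') (s q') by apply: sub; rewrite tree_rel_s//; lia.
  by split=> [[? [? ?]]|[? [? ?]]];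
    [apply: (nc' p q p' q')|apply: (nc' p' q' p q)] => //; lia.
rewrite /tree_rel; case: (ltngtP (r i) (r j)) => [ij|ji|ij].
- by rewrite main// !rK.
- by rewrite [X in _ || X]main ?orbT// !rK es.
- by move: eij; rewrite -[i]rK ij rK ei.
Qed.

Lemma min_dual_diameter P e D : P = conv_hull (range v) ->
  min_dual_diameter_triangulation v P e ->
  (0 < D)%N -> (max_size D.-1 < n <= max_size D)%N ->
  dual_diameter v e = D%:R%:E.
Proof.
move=> PE [te emin] D0 /andP[Dn nD].
have diamE e' t : triangulation v P e' -> leaves t = n.-1 ->
    (forall p q, (p, q) \in edges 0 t -> e' (s p) (s q)) ->
    dual_diameter v e' = (diam t)%:R%:E.
  move=> te' tn tE; have [[[es ei] _ _] _] := te'.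
  exact: (dual_diameterE es ei
    (plane_graph_noncrossing te'.1) tn tE).
have [t [tn tE]] := triangulation_tree PE te.
have [|t' [tn' tD']] := @exists_tree D n.-1; first by lia.
have te' := tree_triangulation PE tn'.
have := emin _ te'; rewrite (diamE _ _ te tn tE) (diamE _ _ te' tn'); last first.
  move=> p q pqT; have := edges_bound pqT; rewrite tn' => pq.
  by rewrite tree_rel_s//; lia.
rewrite lee_fin ler_nat => tt'; congr (_%:R%:E); apply/eqP.
rewrite eqn_leq (leq_trans tt' tD') /= leqNgt; apply/negP => tD.
(* The tree has n - 1 leaves, so a smaller diameter would give n <= [max_size D.-1]. *)
have : (diam t <= D.-1)%N by lia.
by move/leaves_lt_max_size; lia.
Qed.

End Drawing.

Lemma ceil_log2 (R : realType) n m : (0 < m)%N ->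
  (3 * 2 ^ (m - 1) < n <= 3 * 2 ^ m)%N ->
  Num.ceil (log2 (n%:R / 3 : R)) = m%:Z.
Proof.
move=> m0 /andP[mn nm].
have l2 : 0 < ln 2 :> R by rewrite ln_gt0// ltr1n.
have n0 : 0 < n%:R :> R by rewrite ltr0n; lia.
have n30 : 0 < n%:R / 3 :> R by rewrite divr_gt0.
apply: ceil_def; rewrite /log2 ltr_pdivlMr// ler_pdivrMr//.
have -> : (m%:Z - 1)%:~R = (m - 1)%:R :> R by rewrite intrB natrB.
have lo : 2 ^+ (m - 1) < n%:R / 3 :> R.
  by rewrite ltr_pdivlMr// -natrX -natrM ltr_nat mulnC.
have hi : n%:R / 3 <= 2 ^+ m :> R.
  by rewrite ler_pdivrMr// -natrX -natrM ler_nat mulnC.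
rewrite !(mulr_natl (ln 2)) -!lnXn//; apply/andP; split.
  by rewrite ltr_ln ?posrE ?exprn_gt0.
by rewrite ler_ln ?posrE ?exprn_gt0.
Qed.

Theorem proposition2p1 (R : realType) (n m : nat)
    (hn : (3 <= n)%N) (hm : (1 <= m)%N)
    (hnm : (3 * 2 ^ (m - 1) + 1 <= n <= 3 * 2 ^ m)%N)
    (P : set (R * R)) (v : 'I_n -> R * R) (hP : convex_polygon v P)
    (T : rel 'I_n) (hT : min_dual_diameter_triangulation v P T) :
  ((3 * 2 ^ (m - 1) + 1 <= n <= 4 * 2 ^ (m - 1))%N ->
     dual_diameter v T = (2 * Num.ceil (log2 (n%:R / 3 : R)) - 1)%:~R%:E) /\
  ((4 * 2 ^ (m - 1) + 1 <= n <= 3 * 2 ^ m)%N ->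
     dual_diameter v T = (2 * Num.ceil (log2 (n%:R / 3 : R)))%:~R%:E).
Proof.
have [PE hv] := hP.
have n0 : (0 < n)%N by lia.
have [s [r [rK r_lt sK hw]]] := exists_ccw_order (Ordinal n0) hv.
have diamE := min_dual_diameter hn rK r_lt sK hw PE hT.
rewrite (@ceil_log2 R n m hm); last by move: hnm; lia.
(* From here m is one less than in the statement: the two ranges lie between the values 3 * 2 ^ m, 4
   * 2 ^ m and 6 * 2 ^ m of [max_size] at 2m, 2m + 1 and 2m + 2. *)
case: m hm hnm => [//|m] _ _; rewrite subSS subn0; split=> hnm.
- rewrite (diamE m.*2.+1) //.
    by congr (_%:E); rewrite [RHS](_ : _ = (m.*2.+1%:Z)%:~R)//; congr (_%:~R); lia.
  by rewrite /max_size /= odd_double /= uphalf_double doubleK; lia.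
- rewrite (diamE m.*2.+2) //.
    by congr (_%:E); rewrite [RHS](_ : _ = (m.*2.+2%:Z)%:~R)//; congr (_%:~R); lia.
  by rewrite /max_size /= odd_double /= uphalf_double doubleK; lia.
Qed.
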